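(* Let $S$ be a smooth surface. There exists an element $f\in\mathrm{Homeo}(S)\setminus\mathrm{Homeo}^1(S)$ such that (a) $f$ maps every $C^1$ curve in $S$ to a $C^1$ curve, and (b) the induced map $\bar{d}f_p:\mathbb{P}T_pS\to\mathbb{P}T_{f(p)}S$ is a homeomorphism for all $p\in S$.
   Context: A $C^1$ curve in a smooth surface $S$ is a simple closed curve in $S$ that is a properly embedded one-dimensional $C^1$ submanifold; equivalently, the image of a continuously differentiable injective map $\gamma:S^1\to S$ with $\gamma'(t)\neq 0$ for all $t\in S^1$. $\mathrm{Homeo}(S)$ is the group of homeomorphisms of $S$, and $\mathrm{Homeo}^1(S)$ is the set of $f\in\mathrm{Homeo}(S)$ such that both $f$ and $f^{-1}$ map every $C^1$ curve to a $C^1$ curve. $\mathbb{P}T_pS$ is the projectivization of the tangent space $T_pS$. A homeomorphism $f$ of $S$ that maps every $C^1$ curve to a $C^1$ curve sends $C^1$ curves with the same tangent line at $p$ to $C^1$ curves with the same tangent line at $f(p)$; the induced map $\bar{d}f_p:\mathbb{P}T_pS\to\mathbb{P}T_{f(p)}S$ sends the tangent line at $p$ of a $C^1$ curve $\alpha$ through $p$ to the tangent line at $f(p)$ of $f(\alpha)$. *)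

(* Defs.v *)
From HB Require Import structures.
From mathcomp Require Import all_boot all_order all_algebra.
From mathcomp Require Import all_classical all_reals all_analysis.

Set Implicit Arguments.
Unset Strict Implicit.
Unset Printing Implicit Defensive.

Import Order.TTheory GRing.Theory Num.Theory.
Import numFieldNormedType.Exports.
Local Open Scope classical_set_scope.
Local Open Scope ring_scope.

Definition homeomorphism (X Y : topologicalType) (f : X -> Y) : Prop :=
  exists g : Y -> X,
    [/\ continuous f, continuous g, cancel f g & cancel g f].

(* [Ck U k g] is only meant for open [U]: [g] is of class C^k on [U] iff it is
   differentiable there and all its directional derivatives are C^(k-1). *)
Fixpoint Ck (R : realType) (V W : normedModType R) (U : set V) (k : nat)
    (g : V -> W) : Prop :=
  match k with
  | 0 => forall x, U x -> {for x, continuous g}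
  | k'.+1 => (forall x, U x -> differentiable g x) /\
             (forall v : V, Ck U k' ('D_v g))
  end.

Definition smooth_on (R : realType) (V W : normedModType R) (U : set V)
  (g : V -> W) : Prop := forall k, Ck U k g.

(* A homeomorphism from an open subset of [T] onto an open subset of R^2.  The
   total functions [chart_map] and [chart_inv] take arbitrary values outside
   [chart_dom] and [chart_cod]. *)
Record chart (R : realType) (T : topologicalType) := Chart {
  chart_dom : set T ;
  chart_cod : set (R * R) ;
  chart_map :> T -> R * R ;
  chart_inv : R * R -> T ;
  chart_dom_open : open chart_dom ;
  chart_cod_open : open chart_cod ;
  chart_map_cod : forall p, chart_dom p -> chart_cod (chart_map p) ;
  chart_inv_dom : forall x, chart_cod x -> chart_dom (chart_inv x) ;
  chart_mapK : forall p, chart_dom p -> chart_inv (chart_map p) = p ;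
  chart_invK : forall x, chart_cod x -> chart_map (chart_inv x) = x ;
  chart_map_continuous : forall p, chart_dom p -> {for p, continuous chart_map} ;
  chart_inv_continuous : forall x, chart_cod x -> {for x, continuous chart_inv}
}.

(* Nonempty, without boundary; neither compactness, connectedness nor
   orientability is required. *)
Record smooth_surface (R : realType) := SmoothSurface {
  surface :> topologicalType ;
  surface_nonempty : [set: surface] !=set0 ;
  surface_hausdorff : hausdorff_space surface ;
  surface_countable : @second_countable surface ;
  atlas : set (chart R surface) ;
  atlas_cover : forall p : surface, exists2 c, atlas c & chart_dom c p ;
  atlas_compat : forall c d, atlas c -> atlas d ->
    smooth_on (chart_map c @` (chart_dom c `&` chart_dom d))
              (chart_map d \o chart_inv c)
}.

Arguments atlas {R} s.

Definition chart_at (R : realType) (S : smooth_surface R) (p : S) :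
    chart R S :=
  s2val (cid2 (atlas_cover p)).

(* T_pS is identified with R^2 through the chosen chart [chart_at p]; the
   differential of any other chart at [p] gives a linearly isomorphic model. *)
Definition tangent_space (R : realType) (S : smooth_surface R) (p : S) : Type :=
  (R * R)%type.

HB.instance Definition _ (R : realType) (S : smooth_surface R) (p : S) :=
  NormedModule.copy (tangent_space p) (R * R)%type.

Section Projectivization.
Context {R : realType}.
Implicit Type (V : normedModType R).

Definition nonzero V : set V := [set v : V | v != 0].
Arguments nonzero : clear implicits.

Definition span1 V (v : V) : set V := range (fun a : R => a *: v).

Record projectivization V := ProjLine {
  proj_set :> set V ;
  proj_setP : exists2 v, v != 0 & proj_set = span1 v
}.

Lemma proj_line_subproof V (v : nonzero V) :
  exists2 w : V, w != 0 & span1 (val v) = span1 w.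
Proof. by exists (val v) => //; exact: (set_valP v). Qed.

Definition proj_line V (v : nonzero V) : projectivization V :=
  ProjLine (proj_line_subproof v).

HB.instance Definition _ V := gen_eqMixin (projectivization V).
HB.instance Definition _ V := gen_choiceMixin (projectivization V).

(* The quotient topology of V \ {0}, itself a subspace of V. *)
Definition proj_open V (W : set (projectivization V)) : Prop :=
  open (@proj_line V @^-1` W).

Lemma proj_openT V : proj_open (setT : set (projectivization V)).
Proof. by rewrite /proj_open preimage_setT; exact: openT. Qed.

Lemma proj_openI V : setI_closed (@proj_open V).
Proof. by move=> A B oA oB; rewrite /proj_open preimage_setI; exact: openI. Qed.

Lemma proj_open_bigU V (I : Type) (W : I -> set (projectivization V)) :
  (forall i, proj_open (W i)) -> proj_open (\bigcup_i W i).
Proof.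
move=> oW; rewrite /proj_open preimage_bigcup.
by apply: bigcup_open => i _; exact: oW.
Qed.

HB.instance Definition _ V := isOpenTopological.Build (projectivization V)
  (@proj_openT V) (@proj_openI V) (@proj_open_bigU V).

End Projectivization.

Section Curves.
Context {R : realType} (S : smooth_surface R).
Implicit Types (gamma : R -> S) (C : set S) (f : S -> S).

Definition velocity gamma (t : R) : tangent_space (gamma t) :=
  derive1 (chart_at (gamma t) \o gamma) t.

(* Maps from the circle S^1 = R/Z are represented by 1-periodic maps on R. *)
Definition C1_circle_map gamma : Prop :=
  [/\ forall t, gamma (t + 1) = gamma t,
      continuous gamma &
      forall c t, atlas S c -> chart_dom c (gamma t) ->
        derivable (c \o gamma) t 1 /\ {for t, continuous (derive1 (c \o gamma))}].

Definition C1_parametrization gamma C : Prop :=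
  [/\ C1_circle_map gamma,
      forall s t, 0 <= s < 1 -> 0 <= t < 1 -> gamma s = gamma t -> s = t,
      forall t, velocity gamma t != 0 &
      C = range gamma].

Definition C1_curve C : Prop := exists gamma, C1_parametrization gamma C.

Definition maps_C1_curves f : Prop := forall C, C1_curve C -> C1_curve (f @` C).

Definition Homeo : set (S -> S) := [set f | homeomorphism f].

Definition Homeo1 : set (S -> S) :=
  [set f | exists g : S -> S,
    [/\ continuous f, continuous g, cancel f g & cancel g f] /\
    (maps_C1_curves f /\ maps_C1_curves g)].

Definition PT (p : S) : topologicalType := projectivization (tangent_space p).

Definition is_tangent_line C (p : S) (L : PT p) : Prop :=
  exists gamma t, [/\ C1_parametrization gamma C, gamma t = p &
    (L : set _) = span1 (velocity gamma t)].

(* [F] is the map induced by [f] on tangent lines at [p].  Every line of T_pS is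
   tangent to a C^1 curve and C^1 curves have a unique tangent line at each of
   their points, so [F] is unique when it exists. *)
Definition induced_map f (p : S) (F : PT p -> PT (f p)) : Prop :=
  forall C (L : PT p), is_tangent_line C L -> is_tangent_line (f @` C) (F L).

End Curves.

Arguments Homeo {R} S.
Arguments Homeo1 {R} S.
Arguments induced_map {R S} f p F.

(* Main.v *)
Require Import Defs.
From mathcomp Require Import all_boot all_order all_algebra.
From mathcomp Require Import all_classical all_reals all_analysis.
From mathcomp Require Import ring lra zify.

Set Implicit Arguments.
Unset Strict Implicit.
Unset Printing Implicit Defensive.

Import Order.TTheory GRing.Theory Num.Theory.
Import numFieldNormedType.Exports.
Local Open Scope classical_set_scope.
Local Open Scope ring_scope.

(** The map.  Fix a point [p0] and a chart [c] centred at [p0].  The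
    homeomorphism is the identity away from [p0] and equals, in the chart,
    the radial contraction [x |-> k(|x|^2) x] with
    [k q = exp (- max(0, 1 - q)^2 / q)], which moves the points near [p0]
    towards [p0] exponentially fast: it pinches the surface at [p0].  Off the
    origin it is of class C1 and its differential
    [w |-> k w + 2 k' <x, w> x] is injective because [k' >= 0]
    ([dradial_eq0]), so only curves through [p0] need attention.

    Why C1 curves are preserved.  Let [y t = t u(t)] be a curve with [y 0 = 0]
    and [y' 0 = v <> 0].  The velocity of the image is [a y' + b u] with
    [a = k] and [b = 2 k' <y, y'> t].  As [k' / k] grows like [1 / |x|^4],
    [a / b = O(t^2)], so the direction of the image is governed by the secants
    [u(t)], which tend to [v], and hardly by the velocities [y' t]
    ([radial_direction]).  The image velocity itself tends to [0], so the
    image must be reparametrized: near [p0] the coordinate of the image along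
    [v] is a good parameter, and a cut-off function glues it to the old
    parameter ([reparametrize], [pinch_curve]).  In particular the tangent line
    at [p0] is kept, and the induced map on lines is the identity at [p0] and
    the projectivization of an invertible linear map elsewhere
    ([pinch_induced]).

    Why the inverse does not preserve C1 curves.  The argument above uses only
    that [y] is differentiable at [0], that its velocities stay bounded, and
    that they keep a component along [v]: they need not converge.  So the
    pinch sends to a C1 curve some closed curve that is not one, namely [wild],
    a circle sheared by [x^2 cos (1/x)] ([wild_curve_image_C1]).  A C1
    parametrization of that curve would make the derivative of
    [x^2 cos (1/x)] tend to [0] along points reaching every small abscissa of
    one sign, although it takes the values 1 and -1 arbitrarily close to [0]
    ([no_C1_oscillation]). *)

(** * Derivatives of plane curves *)

Section Calculus.
Context {R : realType}.

Lemma is_derive_cvgP (V : normedModType R) (f : R -> V) (t : R) (w : V) :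
  is_derive t 1 f w <->
  h^-1 *: (f (h + t) - f t) @[h --> (0:R)^'] --> w.
Proof.
have E : (fun h : R => h^-1 *: ((f \o shift t) (h *: (1:R)) - f t)) =
         (fun h : R => h^-1 *: (f (h + t) - f t)).
  by apply/funext => h /=; rewrite /GRing.scale /= mulr1.
split => [[d <-]|cv].
  by move: d; rewrite /derivable /derive E.
by apply: DeriveDef; rewrite /derivable /derive E; [apply: cvgP cv|apply: cvg_lim].
Qed.

Lemma is_derive_pairP (y : R -> R * R) (t : R) (w : R * R) :
  is_derive t 1 y w <->
  is_derive t 1 (fun s => (y s).1) w.1 /\ is_derive t 1 (fun s => (y s).2) w.2.
Proof.
rewrite !is_derive_cvgP; split => [cv|[c1 c2]].
  split.
    exact: (cvg_comp (fun h : R => h^-1 *: (y (h + t) - y t)) fst cv cvg_fst).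
  exact: (cvg_comp (fun h : R => h^-1 *: (y (h + t) - y t)) snd cv cvg_snd).
rewrite [w]surjective_pairing.
have -> : (fun h : R => h^-1 *: (y (h + t) - y t)) =
  (fun h => (h^-1 *: ((y (h + t)).1 - (y t).1), h^-1 *: ((y (h + t)).2 - (y t).2))).
  by apply/funext => h.
exact: (cvg_pair c1 c2).
Qed.

Lemma is_derive_pair (f g : R -> R) (t a b : R) :
  is_derive t 1 f a -> is_derive t 1 g b ->
  is_derive t 1 (fun s => (f s, g s)) (a, b).
Proof. by move=> fa gb; apply/is_derive_pairP. Qed.

Lemma is_derive_comp2 (y : R -> R * R) (h : R -> R) (s a : R) (w : R * R) :
  is_derive (h s) 1 y w -> is_derive s 1 h a ->
  is_derive s 1 (y \o h) (a *: w).
Proof.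
move=> /is_derive_pairP[y1 y2] ha; apply/is_derive_pairP => /=; split.
  by rewrite [_ *: _]mulrC; apply: (is_derive1_comp (f := fun s => (y s).1)).
by rewrite [_ *: _]mulrC; apply: (is_derive1_comp (f := fun s => (y s).2)).
Qed.

Lemma is_derive_continuous (V : normedModType R) (f : R -> V) (t : R) (w : V) :
  is_derive t 1 f w -> {for t, continuous f}.
Proof. by case=> d _; apply/differentiable_continuous/derivable1_diffP. Qed.

(** By the mean value theorem a difference quotient at [a] is a value of [df]
    near [a].  Reparametrized curves are shown to be C1 at the pinched point
    in this way, their derivative being computed off that point only. *)
Lemma is_derive_limit (f df : R -> R) (a l : R) :
  {for a, continuous f} ->
  (\forall x \near a^', is_derive (x : R) 1 f (df x)) ->
  df x @[x --> a^'] --> l -> is_derive a 1 f l.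
Proof.
move=> fa fdf dfl; apply/is_derive_cvgP/cvgrPdist_le => e e0.
have : \forall x \near a^', is_derive (x : R) 1 f (df x) /\ `|l - df x| <= e.
  move/cvgrPdist_le : dfl => /(_ e e0); exact: filterI fdf.
move=> [d /= d0 H].
exists d => //= h hd h0. have {}hd : `|h| < d by move: hd; rewrite /= ?sub0r ?normrN.

have contf x : `|x - a| < d -> {for x, continuous f}.
  move=> xa; have [->//|xNa] := eqVneq x a.
  apply: is_derive_continuous; apply: (H x _ _).1 => //=.
  by rewrite distrC.
have key (u v : R) : u < v -> `|u - a| < d -> `|v - a| < d ->
   (u = a \/ v = a) -> `|l - (f v - f u) / (v - u)| <= e.
  move=> uv ua va uva.
  have inb x : x \in `]u, v[ -> `|x - a| < d /\ x != a.
    rewrite in_itv/= => /andP[ux xv]; split.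
      rewrite ltr_norml; move: ua va; rewrite !ltr_norml.
      by move=> /andP[? ?] /andP[? ?]; apply/andP; split; lra.
    by apply/negP => /eqP xa; case: uva => ?; lra.
  have [||c cuv ->] := @MVT R f df u v uv.
  - move=> x /inb[xa xNa]; apply: (H x _ _).1 => //=; by rewrite distrC.
  - apply: continuous_in_subspaceT => x; rewrite inE/= in_itv/= => /andP[ux xv].
    apply: contf; rewrite ltr_norml; move: ua va; rewrite !ltr_norml.
      by move=> /andP[? ?] /andP[? ?]; apply/andP; split; lra.
  - rewrite mulfK ?subr_eq0 ?gt_eqF//.
    have [ca cNa] := inb _ cuv.
    by apply: (H c _ _).2 => //=; rewrite distrC.
have [h_lt0|h_gt0|hE] := ltgtP h 0; last by rewrite hE eqxx in h0.
  have := key (h + a) a; rewrite subrr normr0 addrK.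
  move=> /(_ ltac:(lra) hd d0 (or_intror erefl)).
  congr (`|l - _| <= e); rewrite /GRing.scale/=.
  by rewrite opprD addrCA subrr addr0 invrN mulrN -mulNr opprB mulrC.
have := key a (h + a); rewrite subrr normr0 addrK.
move=> /(_ ltac:(lra) d0 hd (or_introl erefl)).
by rewrite /GRing.scale/= mulrC.
Qed.

Lemma is_derive_limit2 (y dy : R -> R * R) (a : R) (l : R * R) :
  {for a, continuous y} ->
  (\forall x \near a^', is_derive (x : R) 1 y (dy x)) ->
  dy x @[x --> a^'] --> l -> is_derive a 1 y l.
Proof.
move=> ya ydy dyl; apply/is_derive_pairP; split.
  apply: (is_derive_limit (df := fun x => (dy x).1)).
  - exact: (cvg_comp y fst ya cvg_fst).
  - by apply: filterS ydy => x /is_derive_pairP[].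
  - exact: (cvg_comp dy fst dyl cvg_fst).
apply: (is_derive_limit (df := fun x => (dy x).2)).
- exact: (cvg_comp y snd ya cvg_snd).
- by apply: filterS ydy => x /is_derive_pairP[].
- exact: (cvg_comp dy snd dyl cvg_snd).
Qed.

End Calculus.

(** * Curves of class C1 near a parameter *)

Section C1At.
Context {R : realType}.

(** The derivative is a parameter rather than [derive1 y], so that composition
    rules produce explicit formulas whose limits can be computed. *)
Definition C1_at (V : normedModType R) (y dy : R -> V) (t : R) : Prop :=
  (\forall s \near t, is_derive (s : R) 1 y (dy s)) /\ {for t, continuous dy}.

Lemma C1_at_is_derive (V : normedModType R) (y dy : R -> V) t :
  C1_at y dy t -> is_derive t 1 y (dy t).
Proof. by case=> /nbhs_singleton. Qed.

Lemma C1_at_continuous (V : normedModType R) (y dy : R -> V) t :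
  C1_at y dy t -> {for t, continuous y}.
Proof. by move=> /C1_at_is_derive /is_derive_continuous. Qed.

Lemma C1_at_near_eq (V : normedModType R) (y z dy : R -> V) t :
  (\forall s \near t, y s = z s) -> C1_at y dy t -> C1_at z dy t.
Proof.
move=> /near_join yz [ydy cdy]; split=> //.
by apply: filterS2 yz ydy => s yz; apply: near_eq_is_derive.
Qed.

Lemma C1_at_derive1 (V : normedModType R) (y dy : R -> V) t :
  C1_at y dy t -> C1_at y (derive1 y) t.
Proof.
move=> [ydy cdy]; have E : \forall s \near t, dy s = (derive1 y) s.
  by apply: filterS ydy => s [_ <-]; rewrite derive1E.
split; first by apply: filterS2 ydy E => s + <-.
rewrite /prop_for /continuous_at -(nbhs_singleton E).
by apply: cvg_trans cdy; apply: near_eq_cvg.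
Qed.

Lemma C1_atP (V : normedModType R) (y : R -> V) t :
  C1_at y (derive1 y) t <->
  (\forall s \near t, derivable y (s : R) 1) /\ {for t, continuous (derive1 y)}.
Proof.
split=> -[dy cy]; split=> //; apply: filterS dy => s; first by case.
by move=> dy; apply: DeriveDef => //; rewrite derive1E.
Qed.

Lemma C1_at_comp (y dy : R -> R * R) (h dh : R -> R) (s : R) :
  C1_at y dy (h s) -> C1_at h dh s ->
  C1_at (y \o h) (fun t => dh t *: dy (h t)) s.
Proof.
move=> [ydy cdy] hdh; have ch := C1_at_continuous hdh; case: hdh => hdh cdh.
split; last by apply: cvgZ => //; apply: continuous_comp ch _.
have : \forall t \near s, is_derive (h t) 1 y (dy (h t)) by apply: ch ydy.
by apply: filterS2 hdh => t ? ?; apply: is_derive_comp2.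
Qed.

End C1At.

(** * The radial factor *)

Section Psq.
Context {R : realType}.

(** A C1 function that vanishes on a half-line, from which both the radial
    factor and the cut-off function are built. *)
Definition possqr (x : R) : R := Num.max 0 x ^+ 2.

Lemma possqr_ge0 x : 0 <= possqr x. Proof. exact: sqr_ge0. Qed.

Lemma possqr_le0 x : x <= 0 -> possqr x = 0.
Proof. by move=> x0; rewrite /possqr max_l// expr0n. Qed.

Lemma possqr_pos x : 0 <= x -> possqr x = x ^+ 2.
Proof. by move=> x0; rewrite /possqr max_r. Qed.

Lemma possqr_le x y : x <= y -> possqr x <= possqr y.
Proof.
move=> xy; have max0 z : 0 <= Num.max 0 z :> R by rewrite le_max lexx.
by rewrite /possqr ler_sqr ?nnegrE// ge_max !le_max lexx xy orbT.
Qed.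

Lemma continuous_max0 : continuous (fun x : R => Num.max 0 x).
Proof. by move=> x; apply: continuous_max; [exact: cvg_cst|exact: cvg_id]. Qed.

Lemma is_derive_possqr (x : R) : is_derive x 1 possqr (2 * Num.max 0 x).
Proof.
have [x0|x0|->] := ltgtP x 0.
- rewrite mulr0.
  apply: (@near_eq_is_derive _ _ _ (cst 0)).
  near=> z; rewrite /= possqr_le0// ltW//; near: z.
  exact: lt_nbhsl.
- 
  apply: (@near_eq_is_derive _ _ _ (fun z : R => z ^+ 2)).
    near=> z; rewrite possqr_pos// ltW//; near: z.
    exact: lt_nbhsr.
  have H := @is_deriveX R R id 2 x 1 1 (is_derive_id _ _).
  by apply: (is_derive_eq H); rewrite /= /GRing.scale/=; ring.
- rewrite ?maxxx mulr0; apply/is_derive1_caratheodory.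
  exists (fun z => Num.max 0 z); split; [|exact: continuous_max0|by rewrite maxxx].
  move=> z; rewrite (possqr_le0 (lexx 0)) !subr0.
  have [z0|z0] := leP z 0; first by rewrite possqr_le0 ?mul0r.
  by rewrite possqr_pos 1?ltW.
Unshelve. all: by end_near. Qed.

Lemma continuous_possqr : continuous possqr.
Proof. by move=> x; apply: is_derive_continuous (is_derive_possqr x). Qed.

End Psq.

Section RadialFactor.
Context {R : realType}.

(** The factor by which the pinch contracts, as a function of the squared
    radius.  It equals 1 from 1 on, and decays so fast near 0 that
    its logarithmic derivative blows up like [1 / q ^+ 2]. *)
Definition shrink (q : R) : R := expR (- (possqr (1 - q) / q)).

Definition dshrink (q : R) : R :=
  shrink q * (2 * Num.max 0 (1 - q) / q + possqr (1 - q) / q ^+ 2).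

Lemma shrink_gt0 q : 0 < shrink q. Proof. exact: expR_gt0. Qed.

Lemma shrink_le1 q : 0 <= q -> shrink q <= 1.
Proof. by move=> q0; rewrite expR_le1 oppr_le0 divr_ge0 ?possqr_ge0. Qed.

Lemma shrink_eq1 q : 1 <= q -> shrink q = 1.
Proof. by move=> q1; rewrite /shrink possqr_le0 ?mul0r ?oppr0 ?expR0// subr_le0. Qed.

Lemma shrink_le p q : 0 < p -> p <= q -> shrink p <= shrink q.
Proof.
move=> p0 pq; rewrite ler_expR lerN2 ler_pM ?possqr_ge0 ?invr_ge0//.
- by rewrite (le_trans (ltW p0)).
- by rewrite possqr_le// lerB.
- by rewrite lef_pV2 ?posrE// (lt_le_trans p0).
Qed.

Lemma dshrink_ge0 q : 0 < q -> 0 <= dshrink q.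
Proof.
move=> q0; rewrite mulr_ge0 ?(ltW (shrink_gt0 _))// addr_ge0//.
  by rewrite divr_ge0 ?mulr_ge0 ?le_max ?lexx// ltW.
by rewrite divr_ge0 ?possqr_ge0// sqr_ge0.
Qed.

(** The blow-up of the logarithmic derivative that makes radial velocities
    dominate near the origin. *)
Lemma dshrink_ge q : 0 < q -> q <= 1/2 -> shrink q / (4 * q ^+ 2) <= dshrink q.
Proof.
move=> q0 q1; rewrite /dshrink ler_pM2l ?shrink_gt0//.
apply: (@le_trans _ _ (possqr (1 - q) / q ^+ 2)); last first.
  by rewrite lerDr divr_ge0 ?mulr_ge0 ?le_max ?lexx// ltW.
rewrite invfM ler_pM2r ?invr_gt0 ?exprn_gt0// possqr_pos; last lra.
have -> : 4^-1 = (2^-1) ^+ 2 :> R by field.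
by rewrite ler_sqr ?nnegrE; lra.
Qed.

Lemma is_derive_shrink (q : R) : 0 < q -> is_derive q 1 shrink (dshrink q).
Proof.
move=> q0; have q0' : q != 0 by rewrite gt_eqF.
have d1 : is_derive q 1 (fun z : R => 1 - z) (-1).
  by rewrite -[-1]sub0r; apply: is_deriveB.
have d2 := is_derive1_comp (g := fun z : R => 1 - z) (is_derive_possqr (1 - q)) d1.
have d3 := is_deriveV q0' (is_derive_id q 1).
have d4 := is_deriveM d2 d3.
have d5 := is_deriveN d4.
have d6 := is_derive1_comp (is_derive_expR _) d5.
apply: is_derive_eq (d6) _.
rewrite /dshrink /shrink /= /GRing.scale/=; congr (_ * _).
by field.
Qed.

Lemma continuous_shrink (q : R) : 0 < q -> {for q, continuous shrink}.
Proof. by move=> q0; apply: is_derive_continuous (is_derive_shrink q0). Qed.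

Lemma continuous_dshrink (q : R) : 0 < q -> {for q, continuous dshrink}.
Proof.
move=> q0; have q0' : q != 0 by rewrite gt_eqF.
have c1 : {for q, continuous (fun z : R => 1 - z)}.
  by apply: cvgB; [exact: cvg_cst|exact: cvg_id].
have cV : {for q, continuous (fun z : R => z^-1)} by apply: cvgV => //; exact: cvg_id.
apply: cvgM; first exact: continuous_shrink.
apply: cvgD; apply: cvgM => //.
- apply: cvgM; first exact: cvg_cst.
  exact: continuous_comp c1 (@continuous_max0 R _).
- exact: continuous_comp c1 (@continuous_possqr R _).
- apply: cvgV; first by rewrite expf_neq0.
  exact: exprn_continuous.
Qed.

End RadialFactor.

(** * The radial contraction of the plane *)

Section Plane.
Context {R : realType}.
Implicit Types x w : R * R.

Definition dot x w : R := x.1 * w.1 + x.2 * w.2.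
Definition nsq x : R := dot x x.

Lemma dotZl (a : R) x w : dot (a *: x) w = a * dot x w.
Proof. by rewrite /dot /= /GRing.scale /=; ring. Qed.
Lemma dotZr (a : R) x w : dot x (a *: w) = a * dot x w.
Proof. by rewrite /dot /= /GRing.scale /=; ring. Qed.
Lemma dotDl x y w : dot (x + y) w = dot x w + dot y w.
Proof. by rewrite /dot /=; ring. Qed.
Lemma dotC x w : dot x w = dot w x.
Proof. by rewrite /dot mulrC [_.2 * _]mulrC. Qed.
Lemma dot0r x : dot x 0 = 0.
Proof. by rewrite /dot !mulr0 addr0. Qed.

Lemma nsq_ge0 x : 0 <= nsq x.
Proof. by rewrite /nsq /dot addr_ge0 // -expr2 sqr_ge0. Qed.

Lemma nsqZ (a : R) x : nsq (a *: x) = a ^+ 2 * nsq x.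
Proof. by rewrite /nsq dotZl dotZr mulrA expr2. Qed.

Lemma nsq_eq0 x : (nsq x == 0) = (x == 0).
Proof.
rewrite /nsq /dot paddr_eq0 -?expr2 ?sqr_ge0// !sqrf_eq0.
by case: x => a b; rewrite -[RHS]/((a == 0) && (b == 0)).
Qed.

Lemma nsq_gt0 x : (0 < nsq x) = (x != 0).
Proof. by rewrite lt_def nsq_ge0 andbT nsq_eq0. Qed.

Lemma nsq0 : nsq 0 = 0. Proof. by apply/eqP; rewrite nsq_eq0. Qed.

(** The norm of [R * R] is the maximum norm; this bound compares it with the
    Euclidean one, which is the one that radial maps preserve. *)
Lemma norm_le_nsq x : `|x| <= Num.sqrt (nsq x).
Proof.
case: x => a b; rewrite -[`|(a, b)|]/(Num.max `|a| `|b|) ge_max -!sqrtr_sqr.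
rewrite /nsq /dot /= -!expr2; apply/andP; split; apply: ler_wsqrtr.
  by rewrite lerDl sqr_ge0.
by rewrite lerDr sqr_ge0.
Qed.

Lemma is_derive_dot (y z : R -> R * R) (t : R) (v w : R * R) :
  is_derive t 1 y v -> is_derive t 1 z w ->
  is_derive t 1 (fun s => dot (y s) (z s)) (dot v (z t) + dot (y t) w).
Proof.
move=> /is_derive_pairP[y1 y2] /is_derive_pairP[z1 z2].
have d1 := is_deriveM y1 z1; have d2 := is_deriveM y2 z2.
apply: (is_derive_eq (is_deriveD d1 d2)).
by rewrite /dot /GRing.scale/=; ring.
Qed.

Lemma is_derive_scale2 (k : R -> R) (y : R -> R * R) (t a : R) (w : R * R) :
  is_derive t 1 k a -> is_derive t 1 y w ->
  is_derive t 1 (fun s => k s *: y s) (k t *: w + a *: y t).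
Proof.
move=> ka /is_derive_pairP[y1 y2]; apply/is_derive_pairP; split.
  apply: (is_derive_eq (is_deriveM ka y1)).
  by rewrite /GRing.scale/= /GRing.scale/=; ring.
apply: (is_derive_eq (is_deriveM ka y2)).
by rewrite /GRing.scale/= /GRing.scale/=; ring.
Qed.

Section Limits.
Context {T : Type} {F : set_system T} {FF : Filter F}.

Lemma cvg_fst2 (y : T -> R * R) (a : R * R) : y @ F --> a -> (y t).1 @[t --> F] --> a.1.
Proof. by move=> ya; exact: (cvg_comp y fst ya cvg_fst). Qed.

Lemma cvg_snd2 (y : T -> R * R) (a : R * R) : y @ F --> a -> (y t).2 @[t --> F] --> a.2.
Proof. by move=> ya; exact: (cvg_comp y snd ya cvg_snd). Qed.

Lemma cvg_dot (y z : T -> R * R) (a b : R * R) : y @ F --> a -> z @ F --> b ->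
  dot (y t) (z t) @[t --> F] --> dot a b.
Proof.
move=> ya zb; apply: cvgD; apply: cvgM.
- exact: cvg_fst2 ya.
- exact: cvg_fst2 zb.
- exact: cvg_snd2 ya.
- exact: cvg_snd2 zb.
Qed.

Lemma cvg_nsq (y : T -> R * R) (a : R * R) : y @ F --> a -> nsq (y t) @[t --> F] --> nsq a.
Proof. by move=> ya; exact: cvg_dot. Qed.

Lemma cvg_nsq0 (y : T -> R * R) : nsq (y t) @[t --> F] --> (0 : R) ->
  y @ F --> (0 : R * R).
Proof.
move=> y0; have s0 : Num.sqrt (nsq (y t)) @[t --> F] --> (0 : R).
  by rewrite -[X in _ --> X]sqrtr0; apply: continuous_cvg => //; exact: sqrt_continuous.
apply: norm_cvg0; apply: (squeeze_cvgr _ (cvg_cst 0) s0).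
by apply: nearW => t; rewrite normr_ge0 norm_le_nsq.
Qed.

End Limits.

Definition radial x : R * R := shrink (nsq x) *: x.

Definition dradial x w : R * R :=
  shrink (nsq x) *: w + (dshrink (nsq x) * (2 * dot x w)) *: x.

Lemma radial_id x : 1 <= nsq x -> radial x = x.
Proof. by move=> x1; rewrite /radial shrink_eq1// scale1r. Qed.

Lemma radial0 : radial 0 = 0.
Proof. by rewrite /radial scaler0. Qed.

Lemma nsq_radial_le x : nsq (radial x) <= nsq x.
Proof.
rewrite /radial nsqZ -[leRHS]mul1r ler_wpM2r ?nsq_ge0//.
by rewrite exprn_ile1 ?shrink_le1 ?nsq_ge0// ltW// shrink_gt0.
Qed.

Lemma is_derive_radial (y : R -> R * R) (t : R) (w : R * R) :
  is_derive t 1 y w -> y t != 0 ->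
  is_derive t 1 (radial \o y) (dradial (y t) w).
Proof.
move=> yw yt0; have d1 := is_derive_dot yw yw.
have q0 : 0 < nsq (y t) by rewrite nsq_gt0.
have d2 := is_derive1_comp (g := fun s => nsq (y s)) (is_derive_shrink q0) d1.
apply: (is_derive_eq (is_derive_scale2 d2 yw)).
by rewrite /dradial; congr (_ + (_ * _) *: _); rewrite (dotC w) mulr_natl.
Qed.

Lemma cvg_dradial (T : Type) (F : set_system T) (FF : Filter F)
    (y z : T -> R * R) (a b : R * R) : a != 0 -> y @ F --> a -> z @ F --> b ->
  dradial (y t) (z t) @[t --> F] --> dradial a b.
Proof.
move=> a0 ya zb; have q0 : 0 < nsq a by rewrite nsq_gt0.
have n := cvg_nsq (FF := FF) ya.
apply: cvgD; apply: cvgZ => //.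
  exact: (cvg_comp (fun t => nsq (y t)) shrink n (continuous_shrink q0)).
apply: cvgM; first exact: (cvg_comp (fun t => nsq (y t)) dshrink n (continuous_dshrink q0)).
by apply: cvgM; [exact: cvg_cst|exact: cvg_dot].
Qed.

Lemma C1_at_radial (y dy : R -> R * R) t : y t != 0 -> C1_at y dy t ->
  C1_at (radial \o y) (fun s => dradial (y s) (dy s)) t.
Proof.
move=> yt0 ydy; have cy := C1_at_continuous ydy; case: ydy => ydy cdy.
split; last exact: cvg_dradial.
have : \forall s \near t, y s != 0.
  exact: (cvgr_neq0 (y t) cy yt0).
by apply: filterS2 ydy => s ? ?; apply: is_derive_radial.
Qed.

(** Pairing [dradial x w] with [w] gives [k |w|^2 + 2 k' <x, w>^2], a sum of
    two nonnegative terms. *)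
Lemma dradial_eq0 x w : x != 0 -> dradial x w = 0 -> w = 0.
Proof.
move=> x0 dx; have q0 : 0 < nsq x by rewrite nsq_gt0.
have : dot (dradial x w) w = 0 by rewrite dx dotC dot0r.
rewrite /dradial dotDl !dotZl -/(nsq w) => /eqP.
rewrite paddr_eq0.
- by rewrite mulf_eq0 gt_eqF ?shrink_gt0//= nsq_eq0 => /andP[/eqP].
- by rewrite mulr_ge0 ?nsq_ge0// ltW ?shrink_gt0.
- set d := dot x w; have -> : dshrink (nsq x) * (2 * d) * d = dshrink (nsq x) * (2 * d ^+ 2) by ring.
  apply: mulr_ge0; first exact: dshrink_ge0.
  by apply: mulr_ge0 => //; exact: sqr_ge0.
Qed.

Lemma dradial_linear x (a b : R) v w :
  dradial x (a *: v + b *: w) = a *: dradial x v + b *: dradial x w.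
Proof.
case: x v w => [x1 x2] [v1 v2] [w1 w2]; rewrite /dradial /dot.
by congr pair; rewrite /GRing.scale/= /GRing.scale/=; ring.
Qed.

(** Such a map is onto by the intermediate value theorem.  It serves twice: to
    invert the pinch along radii and to invert changes of parameter. *)
Lemma increasing_homeo (th : R -> R) (d : R) : continuous th ->
  {homo th : x y / x < y} -> (forall t, d <= `|t| -> th t = t) ->
  exists h, [/\ cancel th h, cancel h th & continuous h].
Proof.
move=> cth ith thE.
have surj s : exists t, th t = s.
  set B := Num.max `|s| d.
  have sB : `|s| <= B by rewrite le_max lexx.
  have B0 : 0 <= B by apply: le_trans sB.
  have EB : th B = B by apply: thE; rewrite ger0_norm// le_max lexx orbT.
  have ENB : th (- B) = - B.
    by apply: thE; rewrite normrN ger0_norm// le_max lexx orbT.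
  have NB : - B <= B by rewrite ge0_cp.
  have [|t _ <-] := @IVT R th (- B) B s NB (continuous_subspaceT cth); last by exists t.
  by rewrite EB ENB min_l// max_r// -ler_norml.
have [h hK] := choice surj.
have thK : cancel th h.
  move=> t; have [/ith|/ith|//] := ltgtP (h (th t)) t.
    by rewrite hK ltxx.
  by rewrite hK ltxx.
exists h; split=> // s; rewrite -(hK s).
apply: nbhs_singleton (near_can_continuous _ _).
  by near=> x; exact: thK.
by near=> x; exact: cth.
Unshelve. all: by end_near. Qed.

(** Squared radius of the image as a function of the squared radius, extended
    by the identity to negative numbers so as to be a homeomorphism of [R]. *)
Definition radial_sq (q : R) : R := if q <= 0 then q else shrink q ^+ 2 * q.

Lemma nsq_radial x : nsq (radial x) = radial_sq (nsq x).
Proof.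
rewrite /radial_sq; case: ifP => [q0|_]; last by rewrite nsqZ.
have : nsq x == 0 by rewrite eq_le q0 nsq_ge0.
by rewrite nsq_eq0 => /eqP ->; rewrite radial0.
Qed.

Lemma radial_sq_id q : 1 <= `|q| -> radial_sq q = q.
Proof.
rewrite /radial_sq; case: (leP q 0) => // q0; rewrite gtr0_norm// => q1.
by rewrite shrink_eq1// expr1n mul1r.
Qed.

Lemma radial_sq_lt : {homo radial_sq : x y / x < y}.
Proof.
move=> p q pq; rewrite /radial_sq; case: (leP p 0) => p0; case: (leP q 0) => q0 //.
- by apply: le_lt_trans p0 _; rewrite mulr_gt0// exprn_gt0// shrink_gt0.
- by move: (lt_le_trans (lt_trans p0 pq) q0); rewrite ltxx.
- apply: (@le_lt_trans _ _ (shrink q ^+ 2 * p)).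
    rewrite ler_pM2r// ler_sqr ?nnegrE ?(ltW (shrink_gt0 _))//.
    exact: shrink_le (ltW _).
  by rewrite ltr_pM2l// exprn_gt0// shrink_gt0.
Qed.

Lemma continuous_radial_sq : continuous radial_sq.
Proof.
move=> q; have [q0|q0|->] := ltgtP q 0.
- apply: (@cvg_trans _ (x @[x --> q])); last by rewrite /radial_sq (ltW q0).
  apply: near_eq_cvg; near=> x; rewrite /radial_sq ifT// ltW//; near: x.
  exact: lt_nbhsl.
- have ck : (fun x : R => shrink x ^+ 2 * x) @ q --> shrink q ^+ 2 * q.
    apply: cvgM; last exact: cvg_id.
    apply: (cvg_comp shrink (fun z => z ^+ 2) (continuous_shrink q0)).
    exact: exprn_continuous.
  rewrite /continuous_at {2}/radial_sq leNgt q0/=.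
  apply: (@cvg_trans _ (shrink x ^+ 2 * x @[x --> q])).
    apply: near_eq_cvg; near=> x; rewrite /radial_sq ifF// leNgt; apply/negbF; near: x.
    exact: lt_nbhsr.
  exact: ck.
- rewrite /continuous_at {2}/radial_sq lexx.
  suff c0 : radial_sq @ (0 : R) --> (0 : R) by exact: c0.
  apply: norm_cvg0.
  have n0 : `|x| @[x --> (0 : R)] --> (0 : R).
    by rewrite -[X in _ --> X](normr0 R); apply: cvg_norm; exact: cvg_id.
  apply: (squeeze_cvgr _ (cvg_cst 0) n0); near=> x.
  rewrite normr_ge0/= /radial_sq; case: (leP x 0) => // x0.
  rewrite normrM -[leRHS]mul1r ler_wpM2r// ger0_norm ?sqr_ge0//.
  by rewrite exprn_ile1 ?shrink_le1 ?(ltW (shrink_gt0 _))// ltW.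
Unshelve. all: by end_near. Qed.

Lemma radial_sq0 : radial_sq 0 = 0. Proof. by rewrite /radial_sq lexx. Qed.

Lemma continuous_nsq : continuous nsq.
Proof. by move=> x; apply: cvg_nsq; exact: cvg_id. Qed.

(** At the origin neither the radial map nor its inverse is given by a
    continuous formula, but their squared radii are. *)
Lemma continuous_at0_nsq (f : R * R -> R * R) (m : R -> R) :
  continuous m -> m 0 = 0 -> (forall x, nsq (f x) = m (nsq x)) ->
  {for 0, continuous f}.
Proof.
move=> cm m0 nf; have f0 : f 0 = 0.
  by apply/eqP; rewrite -nsq_eq0 nf nsq0 m0.
have C : {for 0, continuous (m \o nsq)}.
  by apply: continuous_comp; [exact: continuous_nsq|exact: cm].
rewrite /prop_for /continuous_at f0; apply: cvg_nsq0.
have -> : (fun x => nsq (f x)) = m \o nsq by apply/funext.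
by move: C; rewrite /prop_for /continuous_at /= nsq0 m0; apply.
Qed.

Lemma radial_homeo :
  exists g, [/\ continuous radial, continuous g, cancel radial g & cancel g radial].
Proof.
have [h [radial_sqK hK ch]] := increasing_homeo continuous_radial_sq radial_sq_lt radial_sq_id.
have h0 : h 0 = 0 by have := radial_sqK 0; rewrite {1}/radial_sq lexx.
have hgt q : 0 < q -> 0 < h q.
  move=> q0; rewrite ltNge; apply/negP => hq.
  by move: (hK q); rewrite /radial_sq hq => E; rewrite E leNgt q0 in hq.
pose g x := (shrink (h (nsq x)))^-1 *: x.
have kN (q : R) : shrink q != 0 by rewrite gt_eqF ?shrink_gt0.
have nsqg x : nsq (g x) = h (nsq x).
  rewrite /g nsqZ; have [->|x0] := eqVneq x 0; first by rewrite nsq0 mulr0 h0.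
  have q0 : 0 < nsq x by rewrite nsq_gt0.
  rewrite -{2}(hK (nsq x)) /radial_sq leNgt hgt//= mulrA -exprMn mulVf ?kN//.
  by rewrite expr1n mul1r.
have crad : continuous radial.
  move=> x; have [->|x0] := eqVneq x 0.
    exact: continuous_at0_nsq continuous_radial_sq radial_sq0 nsq_radial.
  have q0 : 0 < nsq x by rewrite nsq_gt0.
  apply: cvgZ; last exact: cvg_id.
  exact: (continuous_comp (@continuous_nsq x) (continuous_shrink q0)).
exists g; split=> //.
- move=> x; have [->|x0] := eqVneq x 0.
    exact: continuous_at0_nsq ch h0 nsqg.
  have q0 : 0 < nsq x by rewrite nsq_gt0.
  apply: cvgZ; last exact: cvg_id.
  apply: cvgV; first exact: kN.
  apply: (@continuous_comp _ _ _ (h \o nsq) shrink).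
    by apply: continuous_comp; [exact: continuous_nsq|exact: ch].
  exact: continuous_shrink (hgt _ q0).
- move=> x; rewrite /g nsq_radial radial_sqK /radial scalerA mulVf ?kN//.
  by rewrite scale1r.
- by move=> x; rewrite /radial nsqg /g scalerA mulfV ?kN// scale1r.
Qed.

End Plane.

(** * Changes of charts *)

Section Charts.
Context {R : realType} (S : smooth_surface R).
Implicit Types (c d : chart R S) (gamma : R -> S).

(** The differential at [x] of the change of charts from [c] to [d], written
    with its two partial derivatives because the continuity of each directional
    derivative is what the smoothness of the atlas provides. *)
Definition transition_diff c d (x w : R * R) : R * R :=
  w.1 *: 'D_(1, 0) (d \o chart_inv c) x + w.2 *: 'D_(0, 1) (d \o chart_inv c) x.

Lemma transition_diff_linear c d x (a b : R) v w :
  transition_diff c d x (a *: v + b *: w) =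
  a *: transition_diff c d x v + b *: transition_diff c d x w.
Proof.
rewrite /transition_diff; move: ('D_(1, 0) _ x) ('D_(0, 1) _ x) => [p1 p2] [q1 q2].
by congr pair; rewrite /= /GRing.scale/=; ring.
Qed.

Lemma transition_diff0 c d x : transition_diff c d x 0 = 0.
Proof.
rewrite /transition_diff; move: ('D_(1, 0) _ x) ('D_(0, 1) _ x) => [p1 p2] [q1 q2].
by congr pair; rewrite /= /GRing.scale/=; ring.
Qed.

Lemma chart_dom_near c gamma t : {for t, continuous gamma} ->
  chart_dom c (gamma t) -> \forall s \near t, chart_dom c (gamma s).
Proof. by move=> cg cp; apply: cg; apply: open_nbhs_nbhs; split=> //; exact: chart_dom_open. Qed.

(** Chain rule for the curve read in two charts. *)
Lemma C1_at_transition c d gamma dy t : atlas S c -> atlas S d ->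
  {for t, continuous gamma} -> chart_dom c (gamma t) -> chart_dom d (gamma t) ->
  C1_at (c \o gamma) dy t ->
  C1_at (d \o gamma) (fun s => transition_diff c d (c (gamma s)) (dy s)) t.
Proof.
move=> ac ad cg cp dp ydy; have cy := C1_at_continuous ydy; case: ydy => ydy cdy.
have [dT cT] := atlas_compat ac ad 1%N.
have nU : \forall s \near t, chart_dom c (gamma s) /\ chart_dom d (gamma s).
  by apply: filterI; exact: chart_dom_near.
have inU s : chart_dom c (gamma s) /\ chart_dom d (gamma s) ->
    (chart_map c @` (chart_dom c `&` chart_dom d)) (c (gamma s)).
  by move=> H; exists (gamma s).
set T := d \o chart_inv c in dT cT.
have nj := near_join (chart_dom_near cg cp).
split.
  near=> s.
  have Us : (chart_map c @` (chart_dom c `&` chart_dom d)) (c (gamma s)).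
    by apply: inU; near: s.
  have dTs := dT _ Us.
  have [dys dyE] : is_derive (s : R) 1 (c \o gamma) (dy s) by near: s.
  apply: (@near_eq_is_derive _ _ _ (T \o (c \o gamma))).
    have ns : \forall u \near s, chart_dom c (gamma u) by near: s.
    by apply: filterS ns => u cu; rewrite /T /= chart_mapK.
  have dcg : differentiable (c \o gamma) s by apply/derivable1_diffP.
  apply: DeriveDef; first by apply/derivable1_diffP; apply: differentiable_comp.
  rewrite deriveE; last exact: differentiable_comp.
  have E : 'd (c \o gamma) s 1 = dy s by rewrite -deriveE.
  rewrite diff_comp//= E /transition_diff -/T !deriveE//.
  rewrite -!linearZ -linearD; congr ('d _ _ _).
  by case: (dy s) => a b; congr pair; rewrite /= /GRing.scale/= !mulr0 !mulr1 ?addr0 ?add0r.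
have Ut := inU t (conj cp dp).
apply: cvgD; apply: cvgZ.
- exact: (cvg_fst2 cdy).
- exact: (continuous_comp (f := c \o gamma) (g := 'D_(1, 0) T) cy (cT _ _ Ut)).
- exact: (cvg_snd2 cdy).
- exact: (continuous_comp (f := c \o gamma) (g := 'D_(0, 1) T) cy (cT _ _ Ut)).
Unshelve. all: by end_near. Qed.

Lemma C1_at_unique (V : normedModType R) (y dy dz : R -> V) (t : R) :
  C1_at y dy t -> C1_at y dz t -> dy t = dz t.
Proof. by move=> /C1_at_is_derive[_ <-] /C1_at_is_derive[_ <-]. Qed.

Lemma C1_at_line (x w : R * R) (t : R) :
  C1_at (fun s : R => x + s *: w) (fun=> w) t.
Proof.
split; last exact: cvg_cst.
near=> s; apply/is_derive_pairP; split.
  apply: (is_derive_eq (is_deriveD (is_derive_cst x.1 s 1)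
     (is_deriveM (is_derive_id s 1) (is_derive_cst w.1 s 1)))).
  by rewrite /GRing.scale/= mulr0 mulr1 !add0r.
apply: (is_derive_eq (is_deriveD (is_derive_cst x.2 s 1)
   (is_deriveM (is_derive_id s 1) (is_derive_cst w.2 s 1)))).
by rewrite /GRing.scale/= mulr0 mulr1 !add0r.
Unshelve. all: by end_near. Qed.

(** The changes of charts in both directions are inverse to each other, so
    moving a straight line of velocity [w] to [d] and back gives [w] again. *)
Lemma transition_diff_eq0 c d p w : atlas S c -> atlas S d -> chart_dom c p ->
  chart_dom d p -> transition_diff c d (c p) w = 0 -> w = 0.
Proof.
move=> ac ad cp dp Aw0.
pose y (s : R) := c p + s *: w; pose gamma s := chart_inv c (y s).
have y0 : y 0 = c p by rewrite /y scale0r addr0.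
have g0 : gamma 0 = p by rewrite /gamma y0 chart_mapK.
have cy : {for 0, continuous y} := C1_at_continuous (C1_at_line (c p) w 0).
have cg : {for 0, continuous gamma}.
  apply: continuous_comp; first exact: cy.
  by rewrite y0; apply: chart_inv_continuous; exact: chart_map_cod.
have C : C1_at (c \o gamma) (fun=> w) 0.
  apply: C1_at_near_eq (C1_at_line (c p) w 0).
  have ns : \forall s \near (0 : R), chart_cod c (y s).
    apply: cy; rewrite y0; apply: open_nbhs_nbhs; split; first exact: chart_cod_open.
    exact: chart_map_cod.
  by apply: filterS ns => s cs; rewrite /= /gamma chart_invK.
have D := C1_at_transition ac ad cg _ _ C; rewrite g0 in D; have {}D := D cp dp.
have E := C1_at_transition ad ac cg _ _ D; rewrite g0 in E; have {}E := E dp cp.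
rewrite -(C1_at_unique E C) /= g0 Aw0.
exact: transition_diff0.
Qed.

End Charts.

(** * Regular points of curves in a surface *)

Section Regular.
Context {R : realType} (S : smooth_surface R).
Implicit Types (c d : chart R S) (gamma : R -> S).

Definition linear_inj (A : R * R -> R * R) : Prop :=
  (forall (a b : R) v w, A (a *: v + b *: w) = a *: A v + b *: A w) /\
  (forall w, A w = 0 -> w = 0).

Lemma linear_inj_comp A B : linear_inj A -> linear_inj B -> linear_inj (A \o B).
Proof.
move=> [lA iA] [lB iB]; split; first by move=> a b v w; rewrite /= lB lA.
by move=> w /iA /iB.
Qed.

Lemma linear_inj0 A : linear_inj A -> A 0 = 0.
Proof. by move=> [lA _]; have := lA 0 0 0 0; rewrite !scale0r addr0. Qed.

(** [A] is the differential of [f] at [p] read in [c] and [d], expressed through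
    curves: no other kind of differentiability on the surface is used. *)
Definition pushes_velocities c d (f : S -> S) (p : S) (A : R * R -> R * R) : Prop :=
  forall gamma t dy, gamma t = p -> {for t, continuous gamma} ->
    C1_at (c \o gamma) dy t ->
    exists2 dz, C1_at (d \o (f \o gamma)) dz t & dz t = A (dy t).

(** Charts centred at a prescribed point and containing a prescribed disc are
    obtained from those of the atlas by affine maps, and need not be in the
    atlas themselves. *)
Definition affine_chart c : Prop :=
  exists c0 (a : R) b, [/\ atlas S c0, a != 0, chart_dom c = chart_dom c0 &
    forall p, c p = a *: c0 p + b].

Lemma affine_atlas c : atlas S c -> affine_chart c.
Proof.
move=> ac; exists c, 1, 0; split=> //.
by move=> p; rewrite scale1r addr0.
Qed.

Lemma C1_at_affine (y dy : R -> R * R) (a : R) b t :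
  C1_at y dy t -> C1_at (fun s => a *: y s + b) (fun s => a *: dy s) t.
Proof.
move=> [ydy cdy]; split; last by apply: cvgZ => //; exact: cvg_cst.
apply: filterS ydy => s ys.
have H := is_deriveD (is_derive_scale2 (is_derive_cst a s 1) ys) (is_derive_cst b s 1).
by apply: (is_derive_eq H); rewrite scale0r !addr0.
Qed.

Lemma chart_change c d p : affine_chart c -> affine_chart d ->
  chart_dom c p -> chart_dom d p ->
  exists2 A, linear_inj A & pushes_velocities c d id p A.
Proof.
move=> [c0 [a [b [ac0 a0 dc cE]]]] [d0 [a' [b' [ad0 a'0 dd dE]]]] cp dp.
rewrite dc in cp; rewrite dd in dp.
exists (fun w => a' *: transition_diff c0 d0 (c0 p) (a^-1 *: w)).
  split=> [u v w z|w /eqP].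
    have CA (r q : R) (x : R * R) : r *: (q *: x) = q *: (r *: x).
      by rewrite !scalerA mulrC.
    rewrite [a^-1 *: _]scalerDr (CA _ u) (CA _ v) transition_diff_linear.
    by rewrite scalerDr (CA _ u) (CA _ v).
  rewrite scaler_eq0 (negPf a'0)/= => /eqP /(transition_diff_eq0 ac0 ad0 cp dp) /eqP.
  by rewrite scaler_eq0 invr_eq0 (negPf a0)/= => /eqP.
move=> gamma t dy gt cg C.
have C0 : C1_at (c0 \o gamma) (fun s => a^-1 *: dy s) t.
  apply: C1_at_near_eq (C1_at_affine a^-1 (- (a^-1 *: b)) C).
  by near=> s; rewrite /= cE scalerDr addrK scalerA mulVf// scale1r.
have := C1_at_transition ac0 ad0 cg _ _ C0; rewrite gt => /(_ cp dp) D0.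
exists (fun s => a' *: transition_diff c0 d0 (c0 (gamma s)) (a^-1 *: dy s)); last by rewrite gt.
apply: C1_at_near_eq (C1_at_affine a' b' D0).
by near=> s; rewrite /= dE.
Unshelve. all: by end_near. Qed.

(** Being an immersed C1 curve near [t], tested in one chart;
    [regular_chart] shows that the choice of the chart is immaterial. *)
Definition regular gamma t : Prop :=
  {for t, continuous gamma} /\
  exists c dy, [/\ affine_chart c, chart_dom c (gamma t),
    C1_at (c \o gamma) dy t & dy t != 0].

Lemma regular_chart gamma t c : regular gamma t -> affine_chart c ->
  chart_dom c (gamma t) -> exists2 dy, C1_at (c \o gamma) dy t & dy t != 0.
Proof.
move=> [cg [d [dy [ad dg C dy0]]]] ac cp.
have [A Ali mA] := chart_change ad ac dg cp.
have [dz D E] := mA _ _ _ erefl cg C; exists dz => //.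
by rewrite E; apply: contra dy0 => /eqP /Ali.2 ->.
Qed.

Lemma regular_pushes_velocities c d f p A gamma t : affine_chart c -> affine_chart d ->
  chart_dom c p -> chart_dom d (f p) -> linear_inj A -> pushes_velocities c d f p A ->
  {for p, continuous f} -> gamma t = p -> regular gamma t -> regular (f \o gamma) t.
Proof.
move=> ac ad cp dp Ali mA cf gt rg.
have cg := rg.1.
have [|dy C dy0] := regular_chart rg ac; first by rewrite gt.
have [dz D E] := mA _ _ _ gt cg C.
split; first by apply: continuous_comp => //; rewrite gt.
exists d, dz; split=> //=; first by rewrite gt.
by rewrite E; apply: contra dy0 => /eqP /Ali.2 ->.
Qed.

Lemma pushes_velocities_comp c d e f g p A B :
  pushes_velocities c d f p A -> pushes_velocities d e g (f p) B ->
  {for p, continuous f} -> pushes_velocities c e (g \o f) p (B \o A).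
Proof.
move=> mA mB cf gamma t dy gt cg C.
have [dz D E] := mA _ _ _ gt cg C.
have cfg : {for t, continuous (f \o gamma)} by apply: continuous_comp => //; rewrite gt.
have [|du U V] := mB _ _ _ _ cfg D; first by rewrite /= gt.
by exists du => //; rewrite V E.
Qed.

Lemma chart_atP (p : S) : atlas S (chart_at p) /\ chart_dom (chart_at p) p.
Proof. by rewrite /chart_at; case: (cid2 (atlas_cover p)). Qed.

Lemma affine_chart_at (p : S) : affine_chart (chart_at p).
Proof. exact/affine_atlas/(chart_atP p).1. Qed.

Lemma chart_at_dom (p : S) : chart_dom (chart_at p) p.
Proof. exact: (chart_atP p).2. Qed.

Lemma pushes_velocities_chart_at c d f p A : affine_chart c -> affine_chart d ->
  chart_dom c p -> chart_dom d (f p) -> {for p, continuous f} ->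
  linear_inj A -> pushes_velocities c d f p A ->
  exists2 B, linear_inj B & pushes_velocities (chart_at p) (chart_at (f p)) f p B.
Proof.
move=> ac ad cp dp cf Ali mA.
have [B Bli mB] := chart_change (affine_chart_at p) ac (chart_at_dom p) cp.
have [C Cli mC] := chart_change ad (affine_chart_at (f p)) dp (chart_at_dom (f p)).
exists (C \o (A \o B)); first by do 2 apply: linear_inj_comp => //.
have m1 : pushes_velocities (chart_at p) d (f \o id) p (A \o B).
  by apply: pushes_velocities_comp mB mA _; exact: cvg_id.
exact: (pushes_velocities_comp (f := f) (g := id) m1 mC cf).
Qed.

Lemma velocityE gamma t dy : C1_at (chart_at (gamma t) \o gamma) dy t ->
  velocity gamma t = dy t.
Proof. by move=> /C1_at_is_derive[_ E]; rewrite /velocity derive1E E. Qed.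

(** Reduces the global condition on all charts to a local one at each
    parameter. *)
Lemma C1_parametrizationP gamma C : C1_parametrization gamma C <->
  [/\ forall t, gamma (t + 1) = gamma t,
      forall s t, 0 <= s < 1 -> 0 <= t < 1 -> gamma s = gamma t -> s = t,
      forall t, regular gamma t & C = range gamma].
Proof.
split=> [[[per cg C1] inj v0 ->]|[per inj reg ->]]; split=> //.
  move=> t; split; first exact: cg.
  exists (chart_at (gamma t)), (derive1 (chart_at (gamma t) \o gamma)).
  split; [exact: affine_chart_at|exact: chart_at_dom| |exact: v0].
  have ca := (chart_atP (gamma t)).1.
  apply/C1_atP; split; last by have [] := C1 _ t ca (chart_at_dom _).
  apply: filterS (chart_dom_near (cg t) (chart_at_dom (gamma t))) => s ds.
  by have [] := C1 _ s ca ds.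
- split=> //; first by move=> t; have [] := reg t.
  move=> c t ac ct.
  have [dy D _] := regular_chart (reg t) (affine_atlas ac) ct.
  have /C1_atP[d0 c0] := C1_at_derive1 D.
  by split; [exact: (nbhs_singleton d0)|exact: c0].
- move=> t; have [dy D d0] := regular_chart (reg t) (affine_chart_at _) (chart_at_dom _).
  by rewrite (velocityE D).
Qed.

(** The disc of squared radius 4 leaves room around the unit disc, on which
    the pinch lives, for the curve [wild] to fit in. *)
Lemma normal_chart (p0 : S) : exists c : chart R S,
  [/\ affine_chart c, chart_dom c p0, c p0 = 0 &
      forall x, nsq x <= 4 -> chart_cod c x].
Proof.
pose c := chart_at p0.
have cp := chart_at_dom p0; rewrite -/c in cp.
have : nbhs (c p0) (chart_cod c).
  by apply: open_nbhs_nbhs; split; [exact: chart_cod_open|exact: chart_map_cod].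
move=> /nbhs_ballP[e /= e0 eB].
(* A ratio of 3 rather than 2, because the disc of squared radius 4 is closed
   while the ball is open. *)
pose a := e / 3; have a0 : a != 0 by rewrite gt_eqF ?divr_gt0.
pose psi x := a *: x + c p0.
have cpsi : continuous psi.
  by move=> x; apply: cvgD; [apply: cvgZ; [exact: cvg_cst|exact: cvg_id]|exact: cvg_cst].
have psiK x : a^-1 *: (psi x - c p0) = x.
  by rewrite /psi addrK scalerA mulVf// scale1r.
have Kpsi x : psi (a^-1 *: (x - c p0)) = x.
  by rewrite /psi scalerA mulfV// scale1r subrK.
pose cod := psi @^-1` chart_cod c.
pose m p := a^-1 *: (c p - c p0); pose inv x := chart_inv c (psi x).
have h1 : open cod by apply: open_comp; [move=> x _; exact: cpsi|exact: chart_cod_open].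
have h2 p : chart_dom c p -> cod (m p).
  by move=> dp; rewrite /cod /= /m Kpsi; exact: chart_map_cod.
have h3 x : cod x -> chart_dom c (inv x) by move=> ?; exact: chart_inv_dom.
have h4 p : chart_dom c p -> inv (m p) = p by move=> ?; rewrite /inv /m Kpsi chart_mapK.
have h5 x : cod x -> m (inv x) = x by move=> ?; rewrite /inv /m chart_invK.
have h6 p : chart_dom c p -> {for p, continuous m}.
  move=> dp; apply: cvgZ; first exact: cvg_cst.
  by apply: cvgB; [exact: chart_map_continuous|exact: cvg_cst].
have h7 x : cod x -> {for x, continuous inv}.
  by move=> cx; apply: continuous_comp; [exact: cpsi|exact: chart_inv_continuous].
exists (Chart (chart_dom_open c) h1 h2 h3 h4 h5 h6 h7); split=> //=.
- exists c, a^-1, (- (a^-1 *: c p0)); split=> //=.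
  + exact: (chart_atP p0).1.
  + by rewrite invr_eq0.
  + by move=> p; rewrite /m scalerBr.
- by rewrite /m subrr scaler0.
- move=> x x4; apply: eB; rewrite -ball_normE /= /psi opprD addrCA subrr addr0.
  rewrite normrN normrZ gtr0_norm ?divr_gt0//.
  apply: (@le_lt_trans _ _ (e / 3 * 2)); last lra.
  rewrite ler_pM2l ?divr_gt0//; apply: le_trans (norm_le_nsq x) _.
  have -> : 2 = Num.sqrt 4 :> R.
    by rewrite -[LHS]gtr0_norm// -sqrtr_sqr; congr Num.sqrt; ring.
  exact: ler_wsqrtr.
Qed.

End Regular.

(** * Maps of the disc transplanted to a surface *)

Section Transplant.
Context {R : realType} (S : smooth_surface R).
Variable c : chart R S.
Hypothesis c_cod : forall x, nsq x <= 4 -> chart_cod c x.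
Implicit Type r : R * R -> R * R.

(** The maps of the plane that can be extended by the identity outside of a
    chart. *)
Definition disc_map r : Prop :=
  [/\ continuous r, forall x, 1 <= nsq x -> r x = x &
      forall x, nsq x <= 1 -> nsq (r x) <= 1].

Definition transplant r (p : S) : S :=
  if `[< chart_dom c p >] then chart_inv c (r (c p)) else p.

Lemma transplantE r p : chart_dom c p -> transplant r p = chart_inv c (r (c p)).
Proof. by rewrite /transplant => cp; case: asboolP. Qed.

Lemma disc_map_cod r x : disc_map r -> chart_cod c x -> chart_cod c (r x).
Proof.
move=> [_ rid r1] cx; have [x1|/ltW x1] := leP (nsq x) 1.
  by apply: c_cod; apply: le_trans (r1 _ x1) _; rewrite ler1n.
by rewrite rid.
Qed.

Lemma transplant_dom r p : disc_map r -> chart_dom c p -> chart_dom c (transplant r p).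
Proof.
move=> dr cp; rewrite transplantE//; apply: chart_inv_dom.
by apply: disc_map_cod => //; exact: chart_map_cod.
Qed.

Lemma chart_transplant r p : disc_map r -> chart_dom c p ->
  c (transplant r p) = r (c p).
Proof.
move=> dr cp; rewrite transplantE// chart_invK//.
by apply: disc_map_cod => //; exact: chart_map_cod.
Qed.

Lemma transplant_cancel r r' : disc_map r -> cancel r r' ->
  cancel (transplant r) (transplant r').
Proof.
move=> dr rK p; have [cp|ncp] := pselect (chart_dom c p).
  rewrite transplantE; last exact: transplant_dom.
  by rewrite chart_transplant// rK chart_mapK.
have E : transplant r p = p by rewrite /transplant; case: asboolP.
by rewrite E /transplant; case: asboolP.
Qed.

(** Compact, contained in the image of the chart, and containing the unit
    disc: off its preimage a transplanted map is the identity. *)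
Definition square : set (R * R) := `[-1, 1]%classic `*` `[-1, 1]%classic.

Lemma square_nsq x : nsq x <= 1 -> square x.
Proof.
have key (a b : R) : a * a + b * b <= 1 -> -1 <= a <= 1.
  move=> ab; rewrite -ler_norml -(@ler_pXn2r _ 2)// ?nnegrE//.
  rewrite real_normK ?num_real// expr1n expr2.
  by apply: le_trans ab; rewrite lerDl -expr2 sqr_ge0.
move=> x1; split; rewrite /= in_itv /=; first exact: key x1.
by apply: (key _ x.1); rewrite addrC.
Qed.

Lemma square_cod x : square x -> chart_cod c x.
Proof.
move=> [/=]; rewrite !in_itv/= -!ler_norml => x1 x2; apply: c_cod.
have key (a : R) : `|a| <= 1 -> a * a <= 1.
  by move=> a1; rewrite -expr2 -real_normK ?num_real// exprn_ile1.
by have := key _ x1; have := key _ x2; rewrite /nsq /dot; lra.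
Qed.

Lemma closed_square : closed (chart_inv c @` square).
Proof.
apply: compact_closed; first exact: surface_hausdorff.
apply: continuous_compact; last by apply: compact_setX; exact: segment_compact.
apply: continuous_in_subspaceT => x; rewrite inE => /square_cod.
exact: chart_inv_continuous.
Qed.

Lemma transplant_id r p : disc_map r -> ~ (chart_inv c @` square) p ->
  transplant r p = p.
Proof.
move=> [_ rid _] np; rewrite /transplant; case: asboolP => // cp.
rewrite rid ?chart_mapK// leNgt; apply/negP => /ltW /square_nsq sq.
by apply: np; exists (c p) => //; rewrite chart_mapK.
Qed.

Lemma transplant_near_id r p : disc_map r -> ~ chart_dom c p ->
  \forall q \near p, transplant r q = q.
Proof.
move=> dr ncp; have ob : open (~` (chart_inv c @` square)).
  by rewrite openC; exact: closed_square.
have : nbhs p (~` (chart_inv c @` square)).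
  apply: open_nbhs_nbhs; split=> // -[x sx xp]; apply: ncp.
  by rewrite -xp; apply: chart_inv_dom; exact: square_cod.
by apply: filterS => q; exact: transplant_id.
Qed.

(** Near a point outside of the chart the map is the identity, because the
    preimage of [square] is compact, hence closed in a Hausdorff space. *)
Lemma transplant_continuous r : disc_map r -> continuous (transplant r).
Proof.
move=> dr p; have [cp|ncp] := pselect (chart_dom c p); last first.
  have nid := transplant_near_id dr ncp.
  rewrite /continuous_at (nbhs_singleton nid).
  apply: (@cvg_trans _ (id @ p)); last exact: cvg_id.
  by apply: near_eq_cvg; apply: filterS nid => q ->.
have C : {for p, continuous (chart_inv c \o (r \o c))}.
  apply: continuous_comp.
    by apply: continuous_comp; [exact: chart_map_continuous|case: dr => cr _ _; exact: cr].
  apply: chart_inv_continuous; apply: disc_map_cod => //; exact: chart_map_cod.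
rewrite /continuous_at transplantE//; apply: cvg_trans C.
have nd : nbhs p (chart_dom c) by apply: open_nbhs_nbhs; split=> //; exact: chart_dom_open.
by apply: near_eq_cvg; apply: filterS nd => q cq; rewrite transplantE.
Qed.

End Transplant.

(** * The pinch at a point *)

Section TheMap.
Context {R : realType} (S : smooth_surface R) (p0 : S) (c : chart R S).
Hypotheses (c_aff : affine_chart c) (cp0 : chart_dom c p0) (c0 : c p0 = 0)
  (c_cod : forall x, nsq x <= 4 -> chart_cod c x).

Definition pinch : S -> S := transplant c (@radial R).

(** The inverse of the contraction fixes what the contraction fixes, hence
    cannot leave the disc. *)
Lemma disc_map_radial g : continuous g -> cancel (@radial R) g -> cancel g (@radial R) ->
  disc_map (@radial R) /\ disc_map g.
Proof.
move=> cg radK gK.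
have gid x : 1 <= nsq x -> g x = x by move=> x1; rewrite -{1}(radial_id x1) radK.
split; split=> //.
- have [g' [cr _ _ _]] := @radial_homeo R; exact: cr.
- by move=> x; exact: radial_id.
- by move=> x; apply: le_trans; exact: nsq_radial_le.
- move=> x x1; have [gx|gx] := leP (nsq (g x)) 1 => //.
  by move: (gx); rewrite ltNge -(radial_id (ltW gx)) gK x1.
Qed.

Lemma pinch_disc : disc_map (@radial R).
Proof.
by have [g [_ cg radK gK]] := @radial_homeo R; have [] := disc_map_radial cg radK gK.
Qed.

Lemma pinch_homeo :
  exists g, [/\ continuous pinch, continuous g, cancel pinch g & cancel g pinch].
Proof.
have [g [_ cg radK gK]] := @radial_homeo R.
have [dr dg] := disc_map_radial cg radK gK.
exists (transplant c g); split.
- exact: transplant_continuous.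
- exact: transplant_continuous.
- exact: transplant_cancel.
- exact: transplant_cancel.
Qed.

Lemma pinch_p0 : pinch p0 = p0.
Proof. by rewrite /pinch transplantE// c0 radial0 -c0 chart_mapK. Qed.

Lemma chart_eq0 p : chart_dom c p -> c p = 0 -> p = p0.
Proof. by move=> cp E; rewrite -[p](chart_mapK cp) E -c0 chart_mapK. Qed.

Lemma dradial_linear_inj (x : R * R) : x != 0 -> linear_inj (dradial x).
Proof. by move=> x0; split; [exact: dradial_linear|move=> w; exact: dradial_eq0]. Qed.

Lemma linear_inj_id : linear_inj (@id (R * R)). Proof. by []. Qed.

(** Off [p0], the pinch is either the identity near [p] or the contraction
    read in [c] off the origin. *)
Lemma pinch_pushes_velocities p : p != p0 ->
  exists2 A, linear_inj A & pushes_velocities (chart_at p) (chart_at (pinch p)) pinch p A.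
Proof.
move=> pp0; have cp : {for p, continuous pinch}.
  exact: (transplant_continuous c_cod pinch_disc).
have [dp|ndp] := pselect (chart_dom c p).
  have cp0' : c p != 0 by apply: contra pp0 => /eqP /(chart_eq0 dp) ->.
  apply: (pushes_velocities_chart_at c_aff c_aff dp _ cp (dradial_linear_inj cp0')).
    exact: transplant_dom pinch_disc _.
  move=> gamma t dy gt cg C.
  exists (fun s => dradial (c (gamma s)) (dy s)); last by rewrite gt.
  have := C1_at_radial (y := c \o gamma) _ C; rewrite /= gt => /(_ cp0').
  apply: C1_at_near_eq.
  have dt : chart_dom c (gamma t) by rewrite gt.
  apply: filterS (chart_dom_near cg dt) => s ds.
  by rewrite /= /pinch (chart_transplant c_cod pinch_disc ds).
have nid := transplant_near_id c_cod pinch_disc ndp.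
have E : pinch p = p := nbhs_singleton nid.
rewrite E; exists id; first exact: linear_inj_id.
move=> gamma t dy gt cg C; exists dy => //.
apply: C1_at_near_eq C.
rewrite -gt in nid.
have ng : \forall s \near t, transplant c (@radial R) (gamma s) = gamma s.
  exact: (cg _ nid).
by apply: filterS ng => s sE; rewrite /= /pinch sE.
Qed.

Lemma pinch_regular gamma t : gamma t != p0 -> regular gamma t ->
  regular (pinch \o gamma) t.
Proof.
move=> gt rg; have [A Ali mA] := pinch_pushes_velocities gt.
apply: (regular_pushes_velocities _ _ _ _ Ali mA _ erefl rg).
- exact: affine_chart_at.
- exact: affine_chart_at.
- exact: chart_at_dom.
- exact: chart_at_dom.
- exact: (transplant_continuous c_cod pinch_disc).
Qed.

End TheMap.

(** * Tangent direction of a pinched curve *)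

(** The derivative [D] of the radial factor grows like the inverse square of the
    squared radius [T * m], which outweighs the factor [T] of the product. *)
Lemma weight_bound (R : realType) (A D T n m d : R) :
  0 < A -> 0 < T -> 0 < n -> 0 < m -> m <= 2 * n -> n / 4 <= d ->
  A / (4 * (T * m) ^+ 2) <= D -> A / (32 * n * T) <= D * (2 * T * d).
Proof.
move=> A0 T0 n0 m0 mn nd AD.
apply: (@le_trans _ _ (A / (4 * (T * m) ^+ 2) * (2 * T * (n / 4)))).
  rewrite -subr_ge0.
  have -> : A / (4 * (T * m) ^+ 2) * (2 * T * (n / 4)) - A / (32 * n * T) =
      A / (32 * n * T * m ^+ 2) * ((2 * n) ^+ 2 - m ^+ 2).
    by field; rewrite !gt_eqF.
  apply: mulr_ge0; last by rewrite subr_ge0 ler_sqr ?nnegrE// ltW// mulr_gt0.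
  by rewrite divr_ge0 ?mulr_ge0 ?sqr_ge0// ltW.
apply: ler_pM => //; last by rewrite ler_pM2l// mulr_gt0.
  by rewrite divr_ge0 ?mulr_ge0 ?sqr_ge0// ltW.
by rewrite !mulr_ge0 ?ltW.
Qed.

Section Direction.
Context {R : realType}.
Variables (y dy : R -> R * R) (v : R * R) (M : R).
Hypotheses (y0 : y 0 = 0) (yv : is_derive (0 : R) 1 y v) (v0 : v != 0).
Hypothesis y_near : \forall t \near (0 : R)^',
  [/\ C1_at y dy t, `|dy t| <= M & nsq v / 2 <= dot (dy t) v].

Let u (t : R) : R * R := t^-1 *: y t.
Let a (t : R) := shrink (nsq (y t)).
Let b (t : R) := dshrink (nsq (y t)) * (2 * dot (y t) (dy t)) * t.

Let nv : 0 < nsq v. Proof. by rewrite nsq_gt0. Qed.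

Lemma secant_cvg : u t @[t --> (0 : R)^'] --> v.
Proof.
have /is_derive_cvgP := yv; rewrite y0.
by under eq_fun do rewrite addr0 subr0.
Qed.

Lemma bounded_scale (W : normedModType R) (f : R -> R) (g : R -> W) :
  f t @[t --> (0 : R)^'] --> (0 : R) -> (\forall t \near (0:R)^', `|g t| <= M) ->
  f t *: g t @[t --> (0 : R)^'] --> (0 : W).
Proof.
move=> f0 gM; apply: norm_cvg0.
have F0 : `|f t| * M @[t --> (0 : R)^'] --> (0 : R).
  rewrite -[X in _ --> X](mul0r M); apply: cvgM; last exact: cvg_cst.
  by rewrite -[X in _ --> X](normr0 R); apply: cvg_norm.
apply: (squeeze_cvgr _ (cvg_cst 0) F0).
by apply: filterS gM => t gt; rewrite normr_ge0/= normrZ ler_wpM2l.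
Qed.

(** The velocities are only bounded, but the secants converge to [v], so that
    [<u, y'>] differs from [<v, y'>] by a quantity tending to 0. *)
Lemma dot_secant_dy : \forall t \near (0 : R)^', nsq v / 4 <= dot (u t) (dy t).
Proof.
have ym : \forall t \near (0:R)^', `|dy t| <= M by apply: filterS y_near => t [].
have D : dot (u t - v) (dy t) @[t --> (0 : R)^'] --> (0 : R).
  have uv : u t - v @[t --> (0 : R)^'] --> (0 : R * R).
    by rewrite -(subrr v); apply: cvgB; [exact: secant_cvg|exact: cvg_cst].
  have c1 := cvg_fst2 uv; have c2 := cvg_snd2 uv.
  have E : (0 : R) = 0 + 0 by rewrite addr0.
  rewrite [X in _ --> X]E; apply: cvgD; apply: (bounded_scale (W := R^o)).
  - exact: c1.
  - by apply: filterS ym => t; apply: le_trans; rewrite [leRHS]/(Num.max _ _) le_max lexx.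
  - exact: c2.
  - by apply: filterS ym => t; apply: le_trans; rewrite [leRHS]/(Num.max _ _) le_max lexx orbT.
have /cvgrPdist_le /(_ (nsq v / 4)) := D.
rewrite divr_gt0// => /(_ isT) D'.
near=> t.
have [_ _ h1] : [/\ C1_at y dy t, `|dy t| <= M & nsq v / 2 <= dot (dy t) v] by near: t.
have : `|0 - dot (u t - v) (dy t)| <= nsq v / 4 by near: t.
rewrite sub0r normrN ler_norml => /andP[h2 _].
have -> : dot (u t) (dy t) = dot (u t - v) (dy t) + dot (dy t) v.
  by rewrite [dot (dy t) v]dotC -dotDl subrK.
lra.
Unshelve. all: by end_near. Qed.

Lemma secant_bounds : \forall t \near (0 : R)^',
  [/\ t != 0, y t = t *: u t, nsq v / 2 <= nsq (u t) <= 2 * nsq v,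
      nsq (y t) <= 1 / 2 & y t != 0].
Proof.
have cu := cvg_nsq (FF := dnbhs_filter _) secant_cvg.
have cy : nsq (y t) @[t --> (0 : R)^'] --> (0 : R).
  rewrite -[X in _ --> X](@nsq0 R) -[X in nsq X]y0; apply: cvg_nsq.
  by apply: cvg_within_filter; exact: (is_derive_continuous yv).
move/cvgrPdist_le : cu => /(_ (nsq v / 2)); rewrite divr_gt0// => /(_ isT) cu.
move/cvgrPdist_le : cy => /(_ (1 / 2)); rewrite divr_gt0// => /(_ isT) cy.
near=> t.
have t0 : t != 0 by near: t; exact: nbhs_dnbhs_neq.
have yE : y t = t *: u t by rewrite /u scalerA mulfV// scale1r.
have : `|nsq v - nsq (u t)| <= nsq v / 2 by near: t.
rewrite ler_norml => /andP[h1 h2].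
have h3 : nsq v / 2 <= nsq (u t) by lra.
split=> //; first by rewrite h3/=; lra.
  have : `|0 - nsq (y t)| <= 1 / 2 by near: t.
  by rewrite sub0r normrN ger0_norm// nsq_ge0.
rewrite yE scaler_eq0 (negPf t0)/= -nsq_gt0; apply: lt_le_trans h3.
by rewrite divr_gt0.
Unshelve. all: by end_near. Qed.

(** In the velocity [a y' + b u] of the contracted curve, the weight of [y'] is
    negligible with respect to that of the secant [u]. *)
Lemma tangential_weight : \forall t \near (0 : R)^',
  0 < b t /\ a t / b t <= 32 * nsq v * t ^+ 2.
Proof.
near=> t.
have [t0 yE /andP[u1 u2] q12 yt0] : [/\ t != 0, y t = t *: u t,
   nsq v / 2 <= nsq (u t) <= 2 * nsq v, nsq (y t) <= 1 / 2 & y t != 0].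
  by near: t; exact: secant_bounds.
have ud : nsq v / 4 <= dot (u t) (dy t) by near: t; exact: dot_secant_dy.
have q0 : 0 < nsq (y t) by rewrite nsq_gt0.
have t2 : 0 < t ^+ 2 by rewrite lt_def sqrf_eq0 t0 sqr_ge0.
have a0 : 0 < a t := shrink_gt0 _.
have qE : nsq (y t) = t ^+ 2 * nsq (u t) by rewrite yE nsqZ.
have nu0 : 0 < nsq (u t) by apply: lt_le_trans u1; rewrite divr_gt0.
have bge : a t / (32 * nsq v * t ^+ 2) <= b t.
  have -> : b t = dshrink (nsq (y t)) * (2 * t ^+ 2 * dot (u t) (dy t)).
    by rewrite /b {2}yE dotZl; ring.
  apply: (weight_bound a0 t2 nv nu0 u2 ud); rewrite -qE; exact: dshrink_ge.
have d0 : 0 < 32 * nsq v * t ^+ 2 by apply: mulr_gt0 => //; apply: mulr_gt0.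
have b0 : 0 < b t by apply: lt_le_trans bge; rewrite divr_gt0.
split=> //.
by rewrite ler_pdivrMr// mulrC -ler_pdivrMr.
Unshelve. all: by end_near. Qed.

(** Pairing with this vector is the coordinate along [v], scaled to be 1/2 on
    [v]: the value being less than 1 makes this coordinate of the contracted
    curve smaller than the parameter. *)
Definition half_covector : R * R := (2 * nsq v)^-1 *: v.
Let w := half_covector.

(** The velocity is [b (al y' + u)] with [al = a / b] tending to 0, [y'] bounded
    and [u] tending to [v]; once divided by its component along [w], the
    factor [b] disappears. *)
Lemma radial_direction :
  (\forall t \near (0 : R)^',
     [/\ C1_at (radial \o y) (fun s => dradial (y s) (dy s)) t,
         0 < dot (dradial (y t) (dy t)) w &
         `|dot (radial (y t)) w| <= `|t|]) /\
  (dot (dradial (y t) (dy t)) w)^-1 *: dradial (y t) (dy t)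
     @[t --> (0 : R)^'] --> 2 *: v.
Proof.
pose al t := a t / b t.
pose z t := al t *: dy t + u t.
have al0 : al t @[t --> (0 : R)^'] --> (0 : R).
  have B0 : 32 * nsq v * t ^+ 2 @[t --> (0 : R)^'] --> (0 : R).
    rewrite -[X in _ --> X](mulr0 (32 * nsq v)).
    apply: cvgM; first exact: cvg_cst.
    have E : (0 : R) = (0 : R) ^+ 2 by rewrite expr0n.
    rewrite [X in _ --> X]E; apply: cvg_within_filter; exact: exprn_continuous.
  apply: (squeeze_cvgr _ (cvg_cst 0) B0).
  apply: filterS tangential_weight => t [b0 ->]; rewrite andbT.
  by rewrite divr_ge0 ?ltW// /a shrink_gt0.
have zv : z t @[t --> (0 : R)^'] --> v.
  rewrite -[v]add0r; apply: cvgD; last exact: secant_cvg.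
  by apply: bounded_scale => //; apply: filterS y_near => t [].
have vw : dot v w = 1 / 2 by rewrite /w dotZr -/(nsq v); field; rewrite gt_eqF.
have zw : dot (z t) w @[t --> (0 : R)^'] --> (1 / 2 : R).
  by rewrite -vw; apply: cvg_dot => //; exact: cvg_cst.
have uw : dot (u t) w @[t --> (0 : R)^'] --> (1 / 2 : R).
  by rewrite -vw; apply: cvg_dot; [exact: secant_cvg|exact: cvg_cst].
have zw0 : \forall t \near (0 : R)^', 0 < dot (z t) w.
  by apply: (cvgr_gt _ zw); rewrite divr_gt0.
have uw1 : \forall t \near (0 : R)^', `|dot (u t) w| <= 1.
  move/cvgrPdist_le : uw => /(_ (1 / 2)); rewrite divr_gt0// => /(_ isT).
  by apply: filterS => t; rewrite !ler_norml => /andP[? ?]; apply/andP; split; lra.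
have dYE : \forall t \near (0 : R)^', dradial (y t) (dy t) = b t *: z t /\ 0 < b t.
  apply: filterS2 secant_bounds tangential_weight => t [t0 yE _ _ _] [b0 _].
  split=> //; rewrite /dradial /z scalerDr scalerA /al [b t * _]mulrC divfK ?gt_eqF//.
  by congr (_ + _); rewrite /b -[RHS]scalerA -yE.
split.
  near=> t.
  have [C _ _] : [/\ C1_at y dy t, `|dy t| <= M & nsq v / 2 <= dot (dy t) v] by near: t.
  have [t0 yE _ _ yt0] : [/\ t != 0, y t = t *: u t,
    nsq v / 2 <= nsq (u t) <= 2 * nsq v, nsq (y t) <= 1 / 2 & y t != 0].
    by near: t; exact: secant_bounds.
  have [E b0] : dradial (y t) (dy t) = b t *: z t /\ 0 < b t by near: t.
  split; first exact: C1_at_radial.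
    by rewrite E dotZl mulr_gt0//; near: t.
  rewrite /radial dotZl {2}yE dotZl normrM ger0_norm ?(ltW (shrink_gt0 _))//.
  rewrite -[leRHS]mul1r; apply: ler_pM => //; first by rewrite ltW// shrink_gt0.
    by rewrite shrink_le1// nsq_ge0.
  by rewrite normrM -[leRHS]mulr1 ler_wpM2l//; near: t.
have L : (dot (z t) w)^-1 *: z t @[t --> (0 : R)^'] --> 2 *: v.
  have -> : (2 : R) = (1 / 2)^-1 by rewrite div1r invrK.
  by apply: cvgZ => //; apply: cvgV.
apply: cvg_trans L; apply: near_eq_cvg.
apply: filterS2 dYE zw0 => t [-> b0] z0.
rewrite dotZl scalerA; congr (_ *: _); rewrite invfM mulrAC mulVf ?mul1r//.
by rewrite gt_eqF.
Unshelve. all: by end_near. Qed.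

End Direction.

(** * Reparametrization at the pinched point *)

Section Bump.
Context {R : realType} (d : R).
Hypothesis d0 : 0 < d.

Let z (t : R) : R := t ^+ 2 / d ^+ 2 - 1.

(** A C1 cut-off function: 1 up to [d], 0 from [sqrt 2 d] on, monotone on each
    half-line. *)
Definition bump (t : R) : R := possqr (1 - possqr (z t)).
Definition dbump (t : R) : R :=
  (2 * Num.max 0 (1 - possqr (z t))) * - (2 * Num.max 0 (z t) * (2 * t / d ^+ 2)).

Let d2 : 0 < d ^+ 2. Proof. exact: exprn_gt0. Qed.

Lemma bump_itv t : 0 <= bump t <= 1.
Proof.
rewrite possqr_ge0/=; apply: (@le_trans _ _ (possqr 1)).
  by apply: possqr_le; rewrite gerBl possqr_ge0.
by rewrite possqr_pos// expr1n.
Qed.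

Lemma bump_inner t : `|t| <= d -> bump t = 1 /\ dbump t = 0.
Proof.
move=> td; have z0 : z t <= 0.
  rewrite subr_le0 ler_pdivrMr// mul1r -real_normK ?num_real//.
  by rewrite ler_sqr ?nnegrE// ltW.
by rewrite /bump /dbump (max_l z0) (possqr_le0 z0) subr0 possqr_pos// expr1n mulr0 mul0r oppr0 mulr0.
Qed.

Lemma bump_outer t : 2 * d <= `|t| -> bump t = 0 /\ dbump t = 0.
Proof.
move=> td; have z1 : 1 <= z t.
  rewrite lerBrDr ler_pdivlMr// -[t ^+ 2]real_normK ?num_real//.
  apply: (@le_trans _ _ ((2 * d) ^+ 2)).
    by rewrite exprMn ler_pM2r//; lra.
  by rewrite ler_sqr ?nnegrE// mulr_ge0// ltW.
have p1 : 1 - possqr (z t) <= 0.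
  rewrite subr_le0 possqr_pos; last by apply: le_trans z1.
  by rewrite -{1}(expr1n _ 2) ler_sqr ?nnegrE//; apply: le_trans z1.
by rewrite /bump /dbump (max_l p1) (possqr_le0 p1) mulr0 mul0r.
Qed.

(** The cut-off function decreases with [`|t|]; this is what keeps the glued
    parameter increasing. *)
Lemma dbump_sign t : dbump t * t <= 0.
Proof.
have m0 (x : R) : 0 <= Num.max 0 x by rewrite le_max lexx.
rewrite /dbump; set m := Num.max 0 (z t); set n := Num.max 0 (1 - _).
have -> : 2 * n * - (2 * m * (2 * t / d ^+ 2)) * t = - (8 * n * m * (t ^+ 2 / d ^+ 2)).
  by ring.
rewrite oppr_le0; apply: mulr_ge0; last by apply: divr_ge0; exact: sqr_ge0.
by rewrite !mulr_ge0 ?m0.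
Qed.

Lemma bump_C1 t : C1_at bump dbump t.
Proof.
have dz (s : R) : is_derive s 1 z (2 * s / d ^+ 2).
  have h1 := @is_deriveX R R id 2 s 1 1 (is_derive_id _ _).
  have h2 := is_deriveM h1 (is_derive_cst (d ^+ 2)^-1 s 1).
  apply: (is_derive_eq (is_deriveB h2 (is_derive_cst (1 : R) s 1))).
  by rewrite /GRing.scale/= /GRing.scale/=; field; rewrite gt_eqF.
have cz : continuous z by move=> s; exact: is_derive_continuous (dz s).
have c1 : continuous (fun s => 1 - possqr (z s)).
  move=> s; apply: cvgB; first exact: cvg_cst.
  by apply: continuous_comp; [exact: cz|exact: continuous_possqr].
split.
  near=> s.
  have h1 := is_derive1_comp (is_derive_possqr (z s)) (dz s).
  have h2 := is_deriveB (is_derive_cst (1 : R) s 1) h1.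
  apply: (is_derive_eq (is_derive1_comp (g := fun s => 1 - possqr (z s)) (is_derive_possqr _) h2)).
  by rewrite /dbump sub0r.
apply: cvgM.
  apply: cvgM; first exact: cvg_cst.
  by apply: (@continuous_comp _ _ _ (fun s => 1 - possqr (z s))); [exact: c1|exact: continuous_max0].
apply: cvgN; apply: cvgM.
  apply: cvgM; first exact: cvg_cst.
  by apply: continuous_comp; [exact: cz|exact: continuous_max0].
by apply: cvgM; [apply: cvgM; [exact: cvg_cst|exact: cvg_id]|exact: cvg_cst].
Unshelve. all: by end_near. Qed.

End Bump.

Lemma increasing_of_derive (R : realType) (th dth : R -> R) :
  continuous th -> (forall t : R, t != 0 -> is_derive t 1 th (dth t) /\ 0 < dth t) ->
  {homo th : x y / x < y}.
Proof.
move=> cth dthP.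
have half (s t : R) : s < t -> (0 <= s \/ t <= 0) -> th s < th t.
  move=> st sgn.
  have inN x : x \in `]s, t[ -> x != 0.
    rewrite in_itv/= => /andP[sx xt]; apply/negP => /eqP x0.
    by case: sgn => ?; lra.
  have [x /inN/dthP[] ||x xst E] := @MVT R th dth s t st.
  - by [].
  - exact: continuous_subspaceT.
  - rewrite -subr_gt0 E mulr_gt0 ?subr_gt0//.
    by have [] := dthP _ (inN _ xst).
move=> s t st; have [s0|s0] := leP 0 s; first by apply: half => //; left.
have [t0|t0] := leP t 0; first by apply: half => //; right.
by apply: (@lt_trans _ _ (th 0)); apply: half => //; [right|left].
Qed.

Section Reparametrize.
Context {R : realType}.
Variables (Y dY : R -> R * R) (w e : R * R) (eta : R).
Hypotheses (eta0 : 0 < eta) (cY : {for 0, continuous Y}) (Y0 : Y 0 = 0).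
Hypothesis nearY : \forall t \near (0 : R)^',
  [/\ C1_at Y dY t, 0 < dot (dY t) w & `|dot (Y t) w| <= `|t|].
Hypothesis dirY : (dot (dY t) w)^-1 *: dY t @[t --> (0 : R)^'] --> e.

Lemma C1_at_dot (y dy : R -> R * R) t : C1_at y dy t ->
  C1_at (fun s => dot (y s) w) (fun s => dot (dy s) w) t.
Proof.
move=> [ydy cdy]; split; last by apply: cvg_dot => //; exact: cvg_cst.
apply: filterS ydy => s ys.
apply: (is_derive_eq (is_derive_dot ys (is_derive_cst w s 1))).
by rewrite dot0r addr0.
Qed.

(** The new parameter [th] is the coordinate [s] of [Y] along [w] near 0 and
    [t] farther away, glued by a cut-off function.  It is increasing because
    [|s t| <= |t|].  Along the inverse [h], the velocity of [Y \o h] is [dY]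
    divided by its component along [w], which tends to [e]. *)
Lemma reparametrize : exists th h dh : R -> R,
  [/\ cancel th h, cancel h th, continuous h, th 0 = 0 &
      forall t, eta <= `|t| -> th t = t] /\
  [/\ forall s, s != 0 -> C1_at h dh s /\ dh s != 0 &
      exists2 dz, C1_at (Y \o h) dz 0 & dz 0 = e].
Proof.
have n0 : \forall u \near (0 : R)^', u != 0 by exact: nbhs_dnbhs_neq.
have [dl /= dl0 nY] := nearY.
have {}nY t : t != 0 -> `|t| < dl ->
    [/\ C1_at Y dY t, 0 < dot (dY t) w & `|dot (Y t) w| <= `|t|].
  by move=> t0 td; apply: nY => //=; rewrite sub0r normrN.
(* The cut-off function vanishes from [2 * d] on, and [2 * d] must be smaller
   than both [dl] and [eta]. *)
pose d := Num.min dl eta / 3.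
have me : 0 < Num.min dl eta by rewrite lt_min dl0.
have d0 : 0 < d by rewrite divr_gt0.
have ddl : 2 * d < dl.
  apply: (@lt_le_trans _ _ (Num.min dl eta)); last by rewrite ge_min lexx.
  by rewrite /d; lra.
have deta : 2 * d < eta.
  apply: (@lt_le_trans _ _ (Num.min dl eta)); last by rewrite ge_min lexx orbT.
  by rewrite /d; lra.
pose s t := dot (Y t) w; pose ds t := dot (dY t) w.
pose th t := t + bump d t * (s t - t).
pose dth t := 1 + dbump d t * (s t - t) + bump d t * (ds t - 1).
have th_out t : 2 * d <= `|t| -> th t = t.
  by move=> td; rewrite /th (bump_outer d0 td).1 mul0r addr0.
have th0 : th 0 = 0.
  by rewrite /th /s Y0 dotC dot0r subrr mulr0 addr0.
have sC1 t : t != 0 -> `|t| < dl -> C1_at s ds t.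
  by move=> t0 td; have [C _ _] := nY _ t0 td; exact: C1_at_dot.
have thC1 t : t != 0 -> C1_at th dth t.
  move=> t0; have [td|td] := ltP `|t| dl.
    have [h1 h2] := sC1 _ t0 td; have [k1 k2] := bump_C1 d0 t.
    have cs := C1_at_continuous (sC1 _ t0 td).
    split.
      near=> u.
      have hu : is_derive (u : R) 1 s (ds u) by near: u.
      have ku : is_derive (u : R) 1 (bump d) (dbump d u) by near: u.
      have H := is_deriveM ku (is_deriveB hu (is_derive_id u 1)).
      apply: (is_derive_eq (is_deriveD (is_derive_id u 1) H)).
      by rewrite -[(s - id) u]/(s u - u) /dth /GRing.scale/=; ring.
    apply: cvgD; first (apply: cvgD; first exact: cvg_cst).
      by apply: cvgM; [exact: k2|apply: cvgB; [exact: cs|exact: cvg_id]].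
    apply: cvgM; first exact: C1_at_continuous (bump_C1 d0 t).
    by apply: cvgB; [exact: h2|exact: cvg_cst].
  have nt : \forall u \near t, 2 * d <= `|u|.
    have : {for t, continuous (fun u : R => `|u|)} by apply: cvg_norm; exact: cvg_id.
    move=> /(cvgr_gt _) /(_ _ (lt_le_trans ddl td)).
    by apply: filterS => u /ltW.
  split.
    have nnt := near_join nt; near=> u.
    have nu : \forall x \near u, 2 * d <= `|x| by near: u.
    have H : \forall x \near u, id x = th x.
      by apply: filterS nu => x xd; rewrite th_out.
    apply: (near_eq_is_derive H).
    have [bu dbu] := bump_outer d0 (nbhs_singleton nu).
    by rewrite /dth bu dbu !mul0r !addr0; exact: is_derive_id.
  have E u : 2 * d <= `|u| -> dth u = 1.
    by move=> ud; rewrite /dth; have [-> ->] := bump_outer d0 ud; rewrite !mul0r !addr0.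
  rewrite /prop_for /continuous_at E; last exact: nbhs_singleton nt.
  have L : (fun _ : R => 1 : R) @ (t : R) --> (1 : R) by exact: cvg_cst.
  apply: cvg_trans L; apply: near_eq_cvg.
  by apply: filterS nt => u ud; rewrite E.
have dth_gt0 t : t != 0 -> 0 < dth t.
  move=> t0; have [td|td] := ltP `|t| (2 * d); last first.
    by rewrite /dth; have [-> ->] := bump_outer d0 td; rewrite !mul0r !addr0.
  have [_ dst st] := nY _ t0 (lt_trans td ddl).
  have /andP[b0 b1] := bump_itv d t.
  rewrite -/(ds t) in dst; rewrite -/(s t) in st.
  have sgn : 0 <= dbump d t * (s t - t).
    have := dbump_sign d t; move: st; rewrite ler_norml => /andP[st1 st2].
    have [tp|tn|tz] := ltgtP t 0; last by rewrite tz eqxx in t0.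
      rewrite ltr0_norm// in st1 st2; move=> H.
      have : 0 <= dbump d t by rewrite -(nmulr_lle0 _ tp).
      by move=> ?; rewrite mulr_ge0//; lra.
    rewrite gtr0_norm// in st1 st2; move=> H.
    have : dbump d t <= 0 by rewrite -(pmulr_lle0 _ tn).
    by move=> ?; rewrite mulr_le0//; lra.
  rewrite /dth; have [bz|bn] := eqVneq (bump d t) 0; first by rewrite bz mul0r; lra.
  have bp : 0 < bump d t by rewrite lt_def bn.
  have : 0 < bump d t * ds t by rewrite mulr_gt0.
  by move: sgn; rewrite [bump d t * (_ - 1)]mulrBr mulr1; lra.
have cth : continuous th.
  move=> t; have [->|t0] := eqVneq t 0; last exact: C1_at_continuous (thC1 _ t0).
  have E : th 0 = 0 + bump d 0 * (s 0 - 0) by [].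
  rewrite /continuous_at E.
  apply: cvgD; first exact: cvg_id.
  apply: cvgM; first exact: C1_at_continuous (bump_C1 d0 0).
  by apply: cvgB; [apply: cvg_dot; [exact: cY|exact: cvg_cst]|exact: cvg_id].
have ith : {homo th : x y / x < y}.
  apply: (@increasing_of_derive _ th dth) => // t t0.
  by split; [exact: C1_at_is_derive (thC1 _ t0)|exact: dth_gt0].
have [h [thK hK ch]] := increasing_homeo cth ith th_out.
have h0 : h 0 = 0 by rewrite -{1}th0 thK.
have hN0 u : u != 0 -> h u != 0.
  by apply: contra => /eqP E; rewrite -(hK u) E th0.
pose dh u := (dth (h u))^-1.
have hD (u : R) : u != 0 -> is_derive u 1 h (dh u).
  move=> u0; rewrite -[u in is_derive u]hK.
  apply: is_derive_inverse.
  - by near=> x; exact: thK.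
  - by near=> x; exact: cth.
  - exact: C1_at_is_derive (thC1 _ (hN0 _ u0)).
  - by rewrite gt_eqF// dth_gt0// hN0.
exists th, h, dh; split; split=> //.
- by move=> t te; apply: th_out; apply: le_trans te; exact: ltW.
- move=> u u0; split; last by rewrite /dh invr_eq0 gt_eqF// dth_gt0// hN0.
  split.
    have nu : \forall x \near u, x != 0 by exact: (cvgr_neq0 u (cvg_id (F := nbhs u)) u0).
    by apply: filterS nu => x; exact: hD.
  apply: cvgV; first by rewrite gt_eqF// dth_gt0// hN0.
  apply: continuous_comp; first exact: ch.
  by have [] := thC1 _ (hN0 _ u0).
(* The derivative of [Y \o h] at 0 is obtained as the limit of its derivatives
   at the other points, where [dth = ds] because the cut-off function is 1. *)
- pose dz u := if u == 0 then e else dh u *: dY (h u).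
  have hn : \forall u \near (0 : R), `|h u| < d.
    have : {for 0, continuous (fun u : R => `|h u|)} by apply: cvg_norm; exact: ch.
    by move=> /(cvgr_lt _); apply; rewrite h0 normr0.
  have hn' : \forall u \near (0 : R)^', `|h u| < d /\ u != 0.
    apply: filterI; first exact: nbhs_dnbhs hn.
    exact: n0.
  have dzE (u : R) : `|h u| < d /\ u != 0 ->
      is_derive u 1 (Y \o h) (dz u) /\ dz u = (ds (h u))^-1 *: dY (h u).
    move=> [hu u0]; rewrite /dz (negPf u0); split.
      apply: is_derive_comp2; last exact: hD.
      have [|C _ _] := nY (h u) (hN0 _ u0); last exact: C1_at_is_derive C.
      by apply: lt_trans ddl; apply: lt_trans hu _; lra.
    rewrite /dh /dth; have [-> ->] := bump_inner d0 (ltW hu).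
    by rewrite mul0r addr0 mul1r addrC subrK.
  have dz_lim : dz u @[u --> (0 : R)^'] --> e.
    have hh : h u @[u --> (0 : R)^'] --> (0 : R)^'.
      move=> A [r /= r0 rA].
      have : \forall u \near (0 : R), `|h u| < r.
        have : {for 0, continuous (fun u : R => `|h u|)} by apply: cvg_norm; exact: ch.
        by move=> /(cvgr_lt _); apply; rewrite h0 normr0.
      move=> /nbhs_dnbhs hr.
      apply: filterS2 hr n0 => u hur u0.
      by apply: rA => /=; [rewrite sub0r normrN|exact: hN0].
    have L := cvg_comp h (fun t => (dot (dY t) w)^-1 *: dY t) hh dirY.
    apply: cvg_trans L; apply: near_eq_cvg.
    by apply: filterS hn' => u /dzE[_ ->].
  have dz0 : dz 0 = e by rewrite /dz eqxx.
  have D0 : is_derive (0 : R) 1 (Y \o h) e.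
    apply: (is_derive_limit2 (dy := dz) _ _ dz_lim).
      by apply: continuous_comp; [exact: ch|rewrite h0; exact: cY].
    by apply: filterS hn' => u /dzE[].
  exists dz => //; split; last first.
    by apply/continuous_withinNx; rewrite dz0.
  apply: filterS hn => u hu; have [->|u0] := eqVneq u 0; first by rewrite dz0.
  by have [] := dzE u (conj hu u0).
Unshelve. all: by end_near. Qed.

End Reparametrize.

(** * Periodic curves and periodic reparametrizations *)

Section Periodize.
Context {R : realType}.
Implicit Types (e h : R -> R) (s t : R) (m k : int).

Lemma periodic_int (T : Type) (gamma : R -> T) :
  (forall t, gamma (t + 1) = gamma t) -> forall t k, gamma (t + k%:~R) = gamma t.
Proof.
move=> per; have pn n t : gamma (t + n%:R) = gamma t.
  by elim: n => [|n IHn]; rewrite ?addr0// -natr1 addrA per.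
move=> t [n|n]; first exact: pn.
by rewrite NegzE rmorphN/= -[in RHS](subrK n.+1%:R t) pn.
Qed.

Lemma inj_mod1 (T : Type) (gamma : R -> T) :
  (forall t, gamma (t + 1) = gamma t) ->
  (forall s t, 0 <= s < 1 -> 0 <= t < 1 -> gamma s = gamma t -> s = t) ->
  forall s t, gamma s = gamma t -> exists k, s = t + k%:~R.
Proof.
move=> per inj s t st.
have fr (x : R) : 0 <= x - (Num.floor x)%:~R < 1.
  by have /andP[h1 h2] := floor_itv x; rewrite subr_ge0 h1 ltrBlDl -[X in _ + X]/(1%:~R) -intrD.
have gfr (x : R) : gamma (x - (Num.floor x)%:~R) = gamma x.
  by rewrite -[in RHS](subrK (Num.floor x)%:~R x) (periodic_int per).
have /(inj _ _ (fr s) (fr t)) E : gamma (s - (Num.floor s)%:~R) = gamma (t - (Num.floor t)%:~R).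
  by rewrite !gfr.
exists (Num.floor s - Num.floor t); rewrite rmorphB/=.
by rewrite -[LHS](subrK (Num.floor s)%:~R) E; ring.
Qed.

Lemma int_lt1_eq0 k : `|k%:~R : R| < 1 -> k = 0.
Proof.
rewrite ltr_norml => /andP[]; rewrite -[1]/(1%:~R) -rmorphN/= !ltr_int.
lia.
Qed.

Definition nearest s : int := Num.floor (s + 1 / 2).

Lemma nearestP s : `|s - (nearest s)%:~R| <= 1 / 2.
Proof.
have := floor_itv (s + 1 / 2); rewrite -/(nearest s) intrD => /andP[h1 h2].
by rewrite ler_norml; apply/andP; split; lra.
Qed.

(** The map [e], centred at each integer; [nearest] only serves to choose which
    integer to use. *)
Definition periodize e s : R := (nearest s)%:~R + e (s - (nearest s)%:~R).

(** The displacement of [e] is confined to a neighbourhood of 0, so that its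
    translates by integers do not interfere. *)
Definition id_off_quarter e := forall x : R, 1 / 4 <= `|x| -> e x = x.

(** The formula at an integer remains valid well beyond the half-integers,
    where two formulas overlap, since both are the identity there.  This makes
    [periodize e] locally a translate of [e]. *)
Lemma periodize_near e s m : id_off_quarter e -> `|s - m%:~R| < 3 / 4 ->
  periodize e s = m%:~R + e (s - m%:~R).
Proof.
move=> eid sm; rewrite /periodize; set n := nearest s.
have [->//|nm] := eqVneq n m.
have d1 : 1 <= `|n%:~R - m%:~R : R|.
  rewrite leNgt -rmorphB/=; apply/negP => /int_lt1_eq0 /eqP.
  by rewrite subr_eq0 (negPf nm).
have sn := nearestP s; rewrite -/n in sn.
have tr : `|n%:~R - m%:~R : R| <= `|s - n%:~R| + `|s - m%:~R|.
  by rewrite [`|s - n%:~R|]distrC; apply: le_trans (ler_normD _ _); rewrite addrA subrK.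
by rewrite !eid; [ring|lra|lra].
Qed.

Lemma periodizeDint e s k : id_off_quarter e ->
  periodize e (s + k%:~R) = periodize e s + k%:~R.
Proof.
move=> eid.
have E : s + k%:~R - (nearest s + k)%:~R = s - (nearest s)%:~R.
  by rewrite rmorphD/=; ring.
rewrite (@periodize_near _ _ (nearest s + k)) // E.
  by rewrite /periodize rmorphD/=; ring.
by apply: le_lt_trans (nearestP s) _; lra.
Qed.

Lemma periodize_cancel e h : id_off_quarter e -> id_off_quarter h ->
  cancel e h -> cancel (periodize e) (periodize h).
Proof.
move=> eid hid eK s; set n := nearest s.
have sn : `|s - n%:~R| <= 1 / 2 := nearestP s.
have En : periodize e s - n%:~R = e (s - n%:~R).
  by rewrite /periodize -/n addrC addKr.
have en : `|periodize e s - n%:~R| <= 1 / 2.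
  rewrite En leNgt; apply/negP => lt.
  have := hid (e (s - n%:~R)); rewrite eK => E.
  move: (lt); rewrite -E; last lra.
  by move=> ?; lra.
rewrite (@periodize_near _ _ n) // ?En ?eK; first by ring.
by rewrite -En; lra.
Qed.

Lemma C1_at_shift (V : normedModType R) (y dy : R -> V) (t m : R) : C1_at y dy (t - m) ->
  C1_at (fun s => y (s - m)) (fun s => dy (s - m)) t.
Proof.
have cs : {for t, continuous (fun s : R => s - m)}.
  by apply: cvgB; [exact: cvg_id|exact: cvg_cst].
move=> [ydy cdy]; split; last exact: (continuous_comp cs).
have : \forall s \near t, is_derive (s - m) 1 y (dy (s - m)) := cs _ ydy.
apply: filterS => s /is_derive_cvgP H; apply/is_derive_cvgP.
by under eq_fun do rewrite -addrA.
Qed.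

End Periodize.

(** * Pinched closed curves *)

Section PinchCurve.
Context {R : realType} (S : smooth_surface R) (p0 : S) (c : chart R S).
Hypotheses (c_aff : affine_chart c) (cp0 : chart_dom c p0) (c0 : c p0 = 0)
  (c_cod : forall x, nsq x <= 4 -> chart_cod c x).

Lemma regular_reparam (gamma : R -> S) (H dH : R -> R) s :
  regular gamma (H s) -> C1_at H dH s -> dH s != 0 -> regular (gamma \o H) s.
Proof.
move=> [cg [d [dy [ad gd C dy0]]]] CH dH0; split.
  exact: continuous_comp (C1_at_continuous CH) cg.
exists d, (fun t => dH t *: dy (H t)); split; [exact: ad|exact: gd| |].
  exact: C1_at_comp C CH.
by rewrite scaler_eq0 (negPf dH0) (negPf dy0).
Qed.

Variables (gamma : R -> S) (dy : R -> R * R) (v : R * R) (M : R).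
Hypotheses (per : forall t, gamma (t + 1) = gamma t)
  (inj : forall s t, 0 <= s < 1 -> 0 <= t < 1 -> gamma s = gamma t -> s = t)
  (g0 : gamma 0 = p0) (cg : continuous gamma)
  (reg : forall t, gamma t != p0 -> regular gamma t)
  (yv : is_derive (0 : R) 1 (c \o gamma) v) (v0 : v != 0)
  (y_near : \forall t \near (0 : R)^',
    [/\ C1_at (c \o gamma) dy t, `|dy t| <= M & nsq v / 2 <= dot (dy t) v]).

(** The assumptions on the velocities near 0 hold for any C1 curve through
    [p0] but do not require the velocities to converge: they are also met by
    curves that are not C1 at [p0]. *)
Lemma pinch_curve : exists H : R -> R,
  [/\ C1_parametrization (pinch c \o gamma \o H) (range (pinch c \o gamma)),
      forall t, exists s, H s = t,
      forall s, gamma (H s) != p0 -> exists2 dH, C1_at H dH s & dH s != 0 &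
      forall s, gamma (H s) = p0 ->
        exists2 dz, C1_at (c \o (pinch c \o gamma \o H)) dz s & dz s = 2 *: v].
Proof.
have dr := @pinch_disc R.
have y0 : (c \o gamma) 0 = 0 by rewrite /= g0.
have [nY dirY] := radial_direction y0 yv v0 y_near.
have cy : {for 0, continuous (c \o gamma)} by exact: is_derive_continuous yv.
have cY : {for 0, continuous (@radial R \o (c \o gamma))}.
  by apply: continuous_comp; [exact: cy|case: dr => cr _ _; exact: cr].
have Y0 : (@radial R \o (c \o gamma)) 0 = 0.
  by rewrite -[LHS]/(radial ((c \o gamma) 0)) y0 radial0.
have q0 : 0 < 1 / 4 :> R by rewrite divr_gt0.
have [th [h [dh [[thK hK ch th0 thid] [hC1 [dz hz dz0]]]]]] :=
  reparametrize q0 cY Y0 nY dirY.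
have hid : id_off_quarter h by move=> x xq; rewrite -{1}(thid _ xq) thK.
have h0 : h 0 = 0 by rewrite -{1}th0 thK.
pose H := periodize h.
have HK : cancel H (periodize th) by exact: periodize_cancel.
have KH : cancel (periodize th) H by exact: periodize_cancel.
(* Locally [H] is a translate of [h] by an integer. *)
have Hnear (s : R) m : `|s - m%:~R| < 3 / 4 ->
    \forall u \near s, m%:~R + h (u - m%:~R) = H u.
  move=> sm; have : {for s, continuous (fun u : R => `|u - m%:~R|)}.
    by apply: cvg_norm; apply: cvgB; [exact: cvg_id|exact: cvg_cst].
  move=> /(cvgr_lt _) /(_ _ sm); apply: filterS => u um.
  by rewrite /H (periodize_near (m := m)).
have half (s : R) : `|s - (nearest s)%:~R| < 3 / 4.
  by apply: le_lt_trans (nearestP s) _; lra.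
have cH : continuous H.
  move=> s; have Hn := Hnear _ _ (half s).
  rewrite /continuous_at -(nbhs_singleton Hn).
  have L : {for s, continuous (fun u : R => (nearest s)%:~R + h (u - (nearest s)%:~R))}.
    apply: cvgD; first exact: cvg_cst.
    apply: (@continuous_comp _ _ _ (fun u : R => u - (nearest s)%:~R) h).
      by apply: cvgB; [exact: cvg_id|exact: cvg_cst].
    exact: ch.
  by apply: cvg_trans L; apply: near_eq_cvg; apply: filterS Hn => u ->.
have cp : continuous (pinch c) by exact: transplant_continuous.
have cd : continuous (pinch c \o gamma \o H).
  by move=> s; apply: continuous_comp; [exact: cH|apply: continuous_comp; [exact: cg|exact: cp]].
have H1 s : gamma (H s) != p0 -> exists2 dH, C1_at H dH s & dH s != 0.
  move=> gs; set n := nearest s.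
  have sn0 : s - n%:~R != 0.
    apply: contra gs => /eqP E; rewrite /H /periodize -/n E h0 addr0.
    by rewrite -(add0r n%:~R) (periodic_int per) g0.
  have [C d0] := hC1 _ sn0.
  exists (fun u => dh (u - n%:~R)) => //.
  apply: (C1_at_near_eq (Hnear _ _ (half s))).
  have [C1 C2] := C1_at_shift C; split=> //.
  apply: filterS C1 => u D.
  have D' := is_deriveD (is_derive_cst (n%:~R : R) u 1) D.
  by apply: (is_derive_eq D'); rewrite add0r.
(* The curve meets [p0] at the integers only, and [H] fixes the integers. *)
have gmod s : gamma (H s) = p0 -> exists k : int, s = k%:~R.
  rewrite -g0 => /(inj_mod1 per inj)[k E]; exists k.
  rewrite -[s]HK E add0r -[k%:~R]add0r periodizeDint; last by [].
  rewrite -[X in X + _]/(periodize th 0) (periodize_near (m := 0)) //.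
    by rewrite subr0 th0 !add0r.
  by rewrite subr0 normr0 divr_gt0.
have H2 s : gamma (H s) = p0 ->
    exists2 dz, C1_at (c \o (pinch c \o gamma \o H)) dz s & dz s = 2 *: v.
  move=> gs; have [k sk] := gmod _ gs.
  exists (fun u => dz (u - k%:~R)); last by rewrite sk subrr.
  have C : C1_at (fun u => (@radial R \o (c \o gamma) \o h) (u - k%:~R))
      (fun u => dz (u - k%:~R)) s.
    by apply: C1_at_shift; rewrite sk subrr.
  apply: C1_at_near_eq C.
  have sk' : `|s - k%:~R| < 3 / 4 by rewrite sk subrr normr0 divr_gt0.
  have nd : \forall u \near s, chart_dom c (gamma (H u)).
    have cgH : {for s, continuous (gamma \o H)}.
      by apply: continuous_comp; [exact: cH|exact: cg].
    by apply: (chart_dom_near cgH); rewrite /= gs.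
  apply: filterS2 (Hnear _ _ sk') nd => u Eu du.
  by rewrite /= /pinch (chart_transplant c_cod dr du) -Eu [k%:~R + _]addrC (periodic_int per).
exists H; split; [|by move=> t; exists (periodize th t); exact: KH|exact: H1|exact: H2].
apply/C1_parametrizationP; split.
- move=> t /=; rewrite -[1]/(1%:~R) /H periodizeDint// /=.
  by rewrite (periodic_int per).
- have [pinv [_ _ pK _]] := pinch_homeo c_cod.
  move=> s t s01 t01 /= /(can_inj pK) /(inj_mod1 per inj)[k].
  rewrite /H -periodizeDint// => /(can_inj HK) E.
  have k0 : k = 0.
    apply: (int_lt1_eq0 (R := R)); have -> : k%:~R = s - t by rewrite E; ring.
    by move: s01 t01 => /andP[? ?] /andP[? ?]; rewrite ltr_norml; apply/andP; split; lra.
  by rewrite E k0 addr0.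
- move=> s; have [gs|gs] := eqVneq (gamma (H s)) p0.
    have [dz' C E] := H2 s gs.
    split; first exact: cd.
    exists c, dz'; split=> //; first by rewrite /= gs (pinch_p0 cp0 c0).
    by rewrite E scaler_eq0 (negPf v0) orbF pnatr_eq0.
  have [dH C d0] := H1 s gs.
  apply: regular_reparam C d0.
  exact: (pinch_regular c_aff cp0 c0 c_cod gs (reg gs)).
- rewrite eqEsubset; split=> _ [t _ <-].
    by exists (periodize th t) => //=; rewrite KH.
  by exists (H t).
Qed.

End PinchCurve.

(** * Projective maps of the plane *)

Section Projective.
Context {R : realType}.
Local Notation V := (R * R)%type.
Implicit Types A B : V -> V.

Lemma linear_injZ A (a : R) w : linear_inj A -> A (a *: w) = a *: A w.
Proof. by move=> [lA _]; have := lA a 0 w 0; rewrite !scale0r !addr0. Qed.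

Lemma linear_inj_formula A w : linear_inj A ->
  A w = w.1 *: A (1, 0) + w.2 *: A (0, 1).
Proof.
move=> [lA _]; rewrite -lA; congr A.
by case: w => a b; congr pair; rewrite /= /GRing.scale/= ?mulr0 ?mulr1 ?addr0 ?add0r.
Qed.

Lemma linear_inj_continuous A : linear_inj A -> continuous A.
Proof.
move=> Ali; have -> : A = fun w => w.1 *: A (1, 0) + w.2 *: A (0, 1).
  by apply/funext => w; exact: linear_inj_formula.
move=> w; apply: cvgD; apply: cvgZ; try exact: cvg_cst.
  exact: cvg_fst.
exact: cvg_snd.
Qed.

(** Cramer's formula in the basis formed by the images of [(1, 0)] and
    [(0, 1)]. *)
Lemma linear_inj_inverse A : linear_inj A ->
  exists B, [/\ linear_inj B, cancel A B & cancel B A].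
Proof.
move=> Ali; have AE w := linear_inj_formula w Ali.
set p := A (1, 0) in AE; set q := A (0, 1) in AE.
pose det := p.1 * q.2 - p.2 * q.1.
have det0 : det != 0.
  apply/negP => /eqP d0.
  have Ax x y : A (x, y) = (x * p.1 + y * q.1, x * p.2 + y * q.2) by rewrite AE.
  have /Ali.2[q2 p2] : A (q.2, - p.2) = 0.
    by rewrite Ax; congr pair; [rewrite -[RHS]d0 /det; ring|ring].
  have /Ali.2[q1 p1] : A (q.1, - p.1) = 0.
    by rewrite Ax; congr pair; [ring|rewrite -[RHS]oppr0 -d0 /det; ring].
  have /Ali.2[/eqP] : A (1, 0) = 0.
    move/eqP: p1; rewrite oppr_eq0 => /eqP p1; move/eqP: p2; rewrite oppr_eq0 => /eqP p2.
    by rewrite Ax p1 p2 q1 q2; congr pair; ring.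
  by rewrite oner_eq0.
pose B (x : V) : V := ((q.2 * x.1 - q.1 * x.2) / det, (p.1 * x.2 - p.2 * x.1) / det).
have AK : cancel A B.
  move=> w; rewrite AE /B; case: w => x y.
  by congr pair; rewrite /= /GRing.scale/=; move: det0; rewrite /det => det0; field.
have BK : cancel B A.
  move=> w; rewrite AE /B; case: w => x y.
  by rewrite [p]surjective_pairing [q]surjective_pairing; congr pair;
    rewrite /= /GRing.scale/=; move: det0; rewrite /det => det0; field.
exists B; split=> //; split=> [a b v w|w Bw].
  by congr pair; rewrite /= /GRing.scale/=; field.
by rewrite -(BK w) Bw; exact: linear_inj0.
Qed.

Lemma span1Z (a : R) (v : V) : a != 0 -> span1 (a *: v) = span1 v.
Proof.
move=> a0; rewrite eqEsubset; split=> _ [b _ <-].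
  by exists (b * a) => //; rewrite scalerA.
by exists (b / a) => //; rewrite scalerA divfK.
Qed.

Lemma image_span1 A (v : V) : linear_inj A -> A @` span1 v = span1 (A v).
Proof.
move=> Ali; rewrite eqEsubset; split.
  by move=> _ [_ [a _ <-] <-]; exists a => //; rewrite linear_injZ.
by move=> _ [a _ <-]; exists (a *: v); [exists a|rewrite linear_injZ].
Qed.

Lemma projmap_subproof A (Ali : linear_inj A) (L : projectivization V) :
  exists2 v, v != 0 & A @` L = span1 v.
Proof.
have [v v0 ->] := proj_setP L.
exists (A v); last exact: image_span1.
by apply: contra v0 => /eqP /Ali.2 ->.
Qed.

Definition projmap A (Ali : linear_inj A) (L : projectivization V) :
  projectivization V := ProjLine (projmap_subproof Ali L).

Lemma projectivization_ext (L L' : projectivization V) :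
  (L : set V) = (L' : set V) -> L = L'.
Proof.
case: L => L hL; case: L' => L' hL' /= E.
by move: hL hL'; rewrite E => hL hL'; congr ProjLine; exact: Prop_irrelevance.
Qed.

Lemma projmap_cancel A B (Ali : linear_inj A) (Bli : linear_inj B) :
  cancel A B -> cancel (projmap Ali) (projmap Bli).
Proof.
move=> AK L; apply: projectivization_ext; rewrite /= image_comp.
by rewrite (_ : B \o A = id) ?image_id//; apply/funext.
Qed.

(** The quotient topology reduces the claim to the continuity of the linear
    map on nonzero vectors. *)
Lemma projmap_continuous A (Ali : linear_inj A) : continuous (projmap Ali).
Proof.
apply/continuousP => W oW.
have {oW} [B oB BW] : open (@proj_line R V @^-1` W) := oW.
suff : open (@proj_line R V @^-1` (projmap Ali @^-1` W)) by [].
exists (A @^-1` B); first by apply: open_comp oB => w _; exact: linear_inj_continuous.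
rewrite eqEsubset.
have key (x : @nonzero R V) : exists2 x' : @nonzero R V, set_val x' = A (set_val x) &
    projmap Ali (proj_line x) = proj_line x'.
  have Ax : A (set_val x) \in @nonzero R V.
    rewrite inE /nonzero /=; apply: contra (set_valP x) => /eqP /Ali.2 /eqP.
    by [].
  exists (exist (fun w : V => w \in @nonzero R V) (A (set_val x)) Ax) => //.
  by apply: projectivization_ext; rewrite /= image_span1.
split=> x /=; have [x' xE pE] := key x.
  rewrite pE -xE => Bx; have : (set_val @^-1` B) x' by [].
  by rewrite BW.
rewrite pE => Wx; have : (@proj_line R V @^-1` W) x' by [].
by rewrite -BW /= xE.
Qed.

Lemma projmap_homeo A (Ali : linear_inj A) : homeomorphism (projmap Ali).
Proof.
have [B [Bli AK BK]] := linear_inj_inverse Ali.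
exists (projmap Bli); split; [exact: projmap_continuous|exact: projmap_continuous| |];
  exact: projmap_cancel.
Qed.

End Projective.

(** * Action of the pinch on curves and tangent lines *)

Section Induced.
Context {R : realType} (S : smooth_surface R) (p0 : S) (c : chart R S).
Hypotheses (c_aff : affine_chart c) (cp0 : chart_dom c p0) (c0 : c p0 = 0)
  (c_cod : forall x, nsq x <= 4 -> chart_cod c x).
Implicit Types (gamma : R -> S) (C : set S).

Lemma regular_shift gamma (a t : R) : regular gamma (t + a) ->
  regular (fun s => gamma (s + a)) t.
Proof.
move=> reg; apply: (regular_reparam (H := fun s => s + a) (dH := fun=> 1) reg).
  split; last exact: cvg_cst.
  near=> s; apply: (is_derive_eq (is_deriveD (is_derive_id s 1) (is_derive_cst a s 1))).
  by rewrite addr0.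
by [].
Unshelve. all: by end_near. Qed.

(** Used to bring the parameter of [p0] to 0. *)
Lemma C1_parametrization_shift gamma C (a : R) : C1_parametrization gamma C ->
  C1_parametrization (fun s => gamma (s + a)) C.
Proof.
move=> /C1_parametrizationP[per inj reg ->]; apply/C1_parametrizationP; split.
- by move=> t; rewrite addrAC per.
- move=> s t s01 t01 /(inj_mod1 per inj)[k E].
  have k0 : k = 0.
    apply: (int_lt1_eq0 (R := R)); have -> : k%:~R = s - t.
      by move/(congr1 (fun x => x - a - t)): E; rewrite addrK => ->; ring.
    by move: s01 t01 => /andP[? ?] /andP[? ?]; rewrite ltr_norml; apply/andP; split; lra.
  by move: E; rewrite k0 addr0 => /addIr.
- by move=> t; apply: regular_shift.
- rewrite eqEsubset; split=> _ [t _ <-]; last by exists (t + a).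
  by exists (t - a) => //; rewrite subrK.
Qed.

(** At a regular parameter the velocity is continuous, so it stays close to
    its value [v]. *)
Lemma regular_velocity_bounds gamma : (forall t, regular gamma t) -> gamma 0 = p0 ->
  exists v M, [/\ is_derive (0 : R) 1 (c \o gamma) v, v != 0 &
    \forall t \near (0 : R)^', [/\ C1_at (c \o gamma) (derive1 (c \o gamma)) t,
       `|derive1 (c \o gamma) t| <= M & nsq v / 2 <= dot (derive1 (c \o gamma) t) v]].
Proof.
move=> reg g0; have cg t : {for t, continuous gamma} := (reg t).1.
have D t : chart_dom c (gamma t) ->
    exists2 dy, C1_at (c \o gamma) dy t & dy t != 0.
  by move=> dt; exact: regular_chart (reg t) c_aff dt.
set dy := derive1 (c \o gamma).
have C1 t : chart_dom c (gamma t) -> C1_at (c \o gamma) dy t.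
  by move=> /D[d /C1_at_derive1].
have d0 : chart_dom c (gamma 0) by rewrite g0.
have C0 := C1 _ d0; have [dy' C0' v0'] := D _ d0.
have v0 : dy 0 != 0 by rewrite (C1_at_unique C0 C0').
have cdy : {for 0, continuous dy} by case: C0.
exists (dy 0), (`|dy 0| + 1); split; [exact: C1_at_is_derive C0|exact: v0|].
apply: nbhs_dnbhs.
have n1 : \forall t \near (0 : R), `|dy t| < `|dy 0| + 1.
  have : {for 0, continuous (fun t => `|dy t|)} by apply: cvg_norm; exact: cdy.
  by move=> /(cvgr_lt _); apply; rewrite ltrDl.
have n2 : \forall t \near (0 : R), nsq (dy 0) / 2 < dot (dy t) (dy 0).
  have : {for 0, continuous (fun t => dot (dy t) (dy 0))}.
    by apply: cvg_dot; [exact: cdy|exact: cvg_cst].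
  move=> /(cvgr_gt _); apply; rewrite -/(nsq (dy 0)).
  have : 0 < nsq (dy 0) by rewrite nsq_gt0.
  by move=> ?; lra.
apply: filterS3 n1 n2 (chart_dom_near (cg 0) d0) => t h1 h2 dt.
by split; [exact: C1|exact: ltW|exact: ltW].
Qed.

(** A parametrization of the image of a C1 curve, with enough information on
    the change of parameter [H] to compare velocities: off [p0] the speed is
    multiplied by a nonzero number, and at [p0] the velocity is doubled. *)
Lemma pinch_parametrization gamma C : C1_parametrization gamma C -> exists H : R -> R,
  [/\ C1_parametrization (pinch c \o gamma \o H) (pinch c @` C),
      forall t, exists s, H s = t,
      forall s, gamma (H s) != p0 -> exists2 dH, C1_at H dH s & dH s != 0 &
      forall s, gamma (H s) = p0 -> exists dz dy,
        [/\ C1_at (c \o (pinch c \o gamma \o H)) dz s, C1_at (c \o gamma) dy (H s) &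
          dz s = 2 *: dy (H s)]].
Proof.
move=> gC; have [per inj reg CE] := (C1_parametrizationP gamma C).1 gC.
have imC : pinch c @` C = range (pinch c \o gamma) by rewrite CE image_comp.
have [[a ga]|nga] := pselect (exists a, gamma a = p0); last first.
  have gN t : gamma t != p0 by apply/eqP => gt; apply: nga; exists t.
  exists id; split.
  - apply/C1_parametrizationP; split=> //.
    + by move=> t /=; rewrite per.
    + have [pinv [_ _ pK _]] := pinch_homeo c_cod.
      by move=> s t s01 t01 /= /(can_inj pK); exact: inj.
    + by move=> t; exact: (pinch_regular c_aff cp0 c0 c_cod).
  - by move=> t; exists t.
  - move=> s _; exists (fun=> 1); last exact: oner_neq0.
    by split; [near=> u; exact: is_derive_id|exact: cvg_cst].
  - by move=> s gs; move: (gN s); rewrite gs eqxx.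
pose g (s : R) := gamma (s + a).
have gC' : C1_parametrization g C := C1_parametrization_shift a gC.
have [per' inj' reg' CE'] := (C1_parametrizationP g C).1 gC'.
have g0 : g 0 = p0 by rewrite /g add0r.
have [v [M [yv v0 yn]]] := regular_velocity_bounds reg' g0.
have cg : continuous g by move=> t; exact: (reg' t).1.
have [H [P1 P2 P3 P4]] := pinch_curve c_aff cp0 c0 c_cod per' inj' g0 cg
   (fun t _ => reg' t) yv v0 yn.
exists (fun s => H s + a); split.
- by rewrite CE' image_comp; exact: P1.
- by move=> t; have [s E] := P2 (t - a); exists s; rewrite E subrK.
- move=> s gs; have [dH CH d0] := P3 s gs; exists dH => //.
  have [h1 h2] := CH; split=> //; apply: filterS h1 => u hu.
  by apply: (is_derive_eq (is_deriveD hu (is_derive_cst a u 1))); rewrite addr0.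
- move=> s gs; have [dz Cz E] := P4 s gs.
  have dg : chart_dom c (gamma (H s + a)) by rewrite gs.
  have [dy Cy _] := regular_chart (reg _) c_aff dg.
  exists dz, dy; split=> //; rewrite E; congr (_ *: _).
  have [k kE] : exists k : int, H s = 0 + k%:~R.
    by apply: (inj_mod1 per' inj'); rewrite g0 -gs.
  have gk u : g (u - k%:~R) = g u.
    by rewrite -[in RHS](subrK k%:~R u) (periodic_int per').
  have Hk : H s - k%:~R = 0 by rewrite kE add0r subrr.
  have D1 : is_derive (H s) 1 (c \o g) v.
    have : is_derive (H s - k%:~R) 1 (c \o g) v by rewrite Hk.
    move=> /is_derive_cvgP L; apply/is_derive_cvgP; move: L.
    by rewrite /=; under eq_fun do rewrite addrA !gk.
  have D2 : is_derive (H s) 1 (c \o g) (dy (H s + a)).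
    have := C1_at_is_derive Cy => /is_derive_cvgP L; apply/is_derive_cvgP; move: L.
    by rewrite /g /=; under eq_fun do rewrite addrA.
  by have [_ <-] := D1; have [_ ->] := D2.
Unshelve. all: by end_near. Qed.

Lemma pinch_maps_C1 : maps_C1_curves (pinch c).
Proof.
by move=> C [gamma /pinch_parametrization[H [gC _ _ _]]]; exists (pinch c \o gamma \o H).
Qed.

Lemma is_tangent_lineI gamma C (t : R) p (L : PT p) dy : C1_parametrization gamma C ->
  gamma t = p -> C1_at (chart_at p \o gamma) dy t -> (L : set _) = span1 (dy t) ->
  is_tangent_line C L.
Proof.
move=> gC gt; subst p => Cy LE; exists gamma, t; split=> //.
by rewrite (velocityE Cy).
Qed.

Lemma is_tangent_lineE C p (L : PT p) : is_tangent_line C L ->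
  exists gamma t dy, [/\ C1_parametrization gamma C, gamma t = p,
    C1_at (chart_at p \o gamma) dy t, dy t != 0 & (L : set _) = span1 (dy t)].
Proof.
move=> [gamma [t [gC gt LE]]]; have [_ _ reg _] := (C1_parametrizationP gamma C).1 gC.
subst p.
have [dy Cy d0] := regular_chart (reg t) (affine_chart_at (gamma t)) (chart_at_dom (gamma t)).
by exists gamma, t, dy; split=> //; rewrite LE (velocityE Cy).
Qed.

(** At [p0] the velocity of the image is twice that of the curve, whence the
    identity on lines. *)
Lemma pinch_induced p : exists F : PT p -> PT (pinch c p),
  induced_map (pinch c) p F /\ homeomorphism F.
Proof.
have cpc : continuous (pinch c) by exact: (transplant_continuous c_cod (@pinch_disc R)).
have [pE|pp0] := eqVneq p p0.
  (* Both tangent spaces are read in the chart chosen at [p0]. *)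
  exists (@projmap R id (@linear_inj_id R)); split; last exact: projmap_homeo.
  move=> C L /is_tangent_lineE[gamma [t [dy [gC gt Cy d0 LE]]]].
  have [H [dC surj _ Hp0]] := pinch_parametrization gC.
  have [s Hs] := surj t; have [|dz [dw [Cz Cw E]]] := Hp0 s; first by rewrite Hs gt.
  have ds : (pinch c \o gamma \o H) s = p0 by rewrite /= Hs gt pE; exact: pinch_p0.
  have cd : {for s, continuous (pinch c \o gamma \o H)} by have [[_ cd _] _ _ _] := dC; exact: cd.
  have cg : {for t, continuous gamma} by have [[_ cg _] _ _ _] := gC; exact: cg.
  have [A Ali mA] := chart_change c_aff (affine_chart_at p0) cp0 (chart_at_dom p0).
  rewrite Hs in Cw.
  have [dz' Cz' Ez] := mA _ _ _ ds cd Cz.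
  have [|dw' Cw' Ew] := mA _ _ _ _ cg Cw; first by rewrite gt.
  have Edy : dy t = A (dw t).
    by rewrite -Ew; apply: C1_at_unique Cw'; rewrite -pE.
  apply: (is_tangent_lineI (t := s) (dy := dz') dC).
  - by rewrite /= Hs gt.
  - have -> : pinch c p = p0 by rewrite pE; exact: pinch_p0.
    exact: Cz'.
  - rewrite /= image_id LE Ez E Hs linear_injZ// -Edy span1Z//.
have [A Ali mA] := pinch_pushes_velocities c_aff cp0 c0 c_cod pp0.
exists (@projmap R A Ali); split; last exact: projmap_homeo.
move=> C L /is_tangent_lineE[gamma [t [dy [gC gt Cy d0 LE]]]].
have [H [dC surj Hp Hp0]] := pinch_parametrization gC.
have [s Hs] := surj t.
have [|dH CH dH0] := Hp s; first by rewrite Hs gt.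
have cg : {for t, continuous gamma} by have [[_ cg _] _ _ _] := gC; exact: cg.
have [dz Cz Ez] := mA _ _ _ gt cg Cy.
apply: (is_tangent_lineI (t := s) (dy := fun u => dH u *: dz (H u)) dC).
- by rewrite /= Hs gt.
- have Cz' : C1_at (chart_at (pinch c p) \o (pinch c \o gamma)) dz (H s) by rewrite Hs.
  exact: C1_at_comp Cz' CH.
- by rewrite /= LE image_span1// Hs Ez span1Z.
Qed.

End Induced.

(** * A closed curve with oscillating tangents *)

Section Oscillation.
Context {R : realType}.

(** Differentiable everywhere, with a derivative that is bounded near 0 and has
    no limit there.
    The cosine is chosen so that [dosc] is the derivative at 0 too, where
    [0^-1 = 0]. *)
Definition osc (x : R) : R := x ^+ 2 * cos x^-1.
Definition dosc (x : R) : R := 2 * x * cos x^-1 + sin x^-1.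

Lemma is_derive_osc (x : R) : is_derive x 1 osc (dosc x).
Proof.
have [->|x0] := eqVneq x 0.
  rewrite /dosc invr0 sin0 mulr0 mul0r addr0.
  apply/is_derive1_caratheodory; exists (fun z => z * cos z^-1); split.
  - by move=> z; rewrite /osc invr0 expr0n mul0r !subr0 expr2 mulrAC.
  - rewrite /prop_for /continuous_at mul0r; apply: norm_cvg0.
    have n0 : `|z| @[z --> (0 : R)] --> (0 : R).
      by rewrite -[X in _ --> X](normr0 R); apply: cvg_norm; exact: cvg_id.
    apply: (squeeze_cvgr _ (cvg_cst 0) n0); near=> z.
    by rewrite normr_ge0/= normrM -[leRHS]mulr1 ler_wpM2l// cos_max.
  - by rewrite mul0r.
have h1 := @is_deriveX R R id 2 x 1 1 (is_derive_id _ _).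
have h2 := is_derive1_comp (is_derive_cos x^-1) (is_deriveV x0 (is_derive_id x 1)).
apply: (is_derive_eq (is_deriveM h1 h2)).
by rewrite -[(id ^+ 2) x]/(x ^+ 2) /dosc /= /GRing.scale/= /GRing.scale/=; field.
Unshelve. all: by end_near. Qed.

Lemma continuous_osc : continuous osc.
Proof. by move=> x; exact: is_derive_continuous (is_derive_osc x). Qed.

Lemma continuous_dosc (x : R) : x != 0 -> {for x, continuous dosc}.
Proof.
move=> x0; have cV : {for x, continuous (fun z : R => z^-1)} by apply: cvgV => //; exact: cvg_id.
apply: cvgD.
  apply: cvgM; first by apply: cvgM; [exact: cvg_cst|exact: cvg_id].
  by apply: (continuous_comp cV); exact: continuous_cos.
by apply: (continuous_comp cV); exact: continuous_sin.
Qed.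

Lemma osc0 : osc 0 = 0. Proof. by rewrite /osc expr0n mul0r. Qed.

Lemma dosc0 : dosc 0 = 0.
Proof. by rewrite /dosc invr0 sin0 mulr0 mul0r addr0. Qed.

Lemma osc_le x : `|osc x| <= x ^+ 2.
Proof.
rewrite /osc normrM -[leRHS]mulr1; apply: ler_pM => //; last exact: cos_max.
by rewrite ger0_norm// sqr_ge0.
Qed.

Lemma dosc_le x : `|x| <= 1 -> `|dosc x| <= 3.
Proof.
move=> x1; apply: le_trans (ler_normD _ _) _.
have -> : 3 = 2 + 1 :> R by ring.
apply: lerD; last exact: sin_max.
rewrite normrM -[leRHS]mulr1; apply: ler_pM => //; last exact: cos_max.
by rewrite normrM ger0_norm// -[leRHS]mulr1 ler_wpM2l.
Qed.

(** The peaks are at the inverses of [pi / 2 + 2 n pi] and their opposites. *)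
Lemma dosc_peak (b : R) : b != 0 ->
  exists x, [/\ `|x| < `|b|, 0 < x * b & `|dosc x| = 1].
Proof.
move=> b0; have pi0 : 0 < @pi R := pi_gt0 R.
have nb : 0 < `|b| by rewrite normr_gt0.
pose n := (Num.truncn (`|b|^-1)).+1.
have nP : `|b|^-1 < n%:R.
  by rewrite /n truncnS_gt.
pose z : R := pi / 2 + (pi *+ 2) *+ n.
have zn : n%:R < z.
  rewrite /z -mulrnA -[X in _ < _ + X]mulr_natr natrM.
  have : (n%:R : R) <= pi * (2 * n%:R).
    rewrite mulrA -[leLHS]mul1r ler_wpM2r//.
    by have := @pi_ge2 R; lra.
  by move: pi0; lra.
have z0 : 0 < z by apply: le_lt_trans zn.
have sz : sin z = 1 by rewrite /z periodicn ?sin_pihalf//; exact: sinD2pi.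
have cz : cos z = 0 by rewrite /z periodicn ?cos_pihalf//; exact: cosD2pi.
exists (Num.sg b * z^-1).
have sg0 : Num.sg b != 0 by rewrite sgr_eq0.
have sgV : (Num.sg b)^-1 = Num.sg b.
  have [h|h|h] := ltgtP b 0; last by rewrite h eqxx in b0.
    by rewrite (ltr0_sg h) invrN invr1.
  by rewrite (gtr0_sg h) invr1.
split.
- rewrite normrM normr_sg b0 mul1r gtr0_norm ?invr_gt0//.
  rewrite invf_plt ?posrE//; exact: lt_trans nP zn.
- by rewrite mulrAC mulr_gt0 ?invr_gt0// -normrEsg.
- rewrite /dosc invfM invrK sgV cos_sg// sin_sg cz sz mulr0 add0r mulr1.
  by rewrite normr_sg b0.
Qed.

End Oscillation.

Section WildCurve.
Context {R : realType}.

Definition wild_abscissa (t : R) : R := sin (pi * t) * cos (pi * t).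
(** With [s] and [k] the sine and cosine of [pi t], the point [(s k, s^2)] runs
    along the circle [x^2 = y - y^2] tangent to the first axis at the origin.
    It is moved by the shear [(x, y) |-> (x, y + (1 - y) osc x)]; the factor
    [1 - y = k^2] removes the oscillation at the top of the circle, where [x]
    vanishes as well. *)
Definition wild (t : R) : R * R :=
  (wild_abscissa t, sin (pi * t) ^+ 2 + cos (pi * t) ^+ 2 * osc (wild_abscissa t)).

Definition dwild_abscissa (t : R) : R := pi * (cos (pi * t) ^+ 2 - sin (pi * t) ^+ 2).
Definition dwild (t : R) : R * R :=
  (dwild_abscissa t,
   2 * pi * wild_abscissa t * (1 - osc (wild_abscissa t)) +
   cos (pi * t) ^+ 2 * dosc (wild_abscissa t) * dwild_abscissa t).

Lemma wild_abscissa_le t : wild_abscissa t ^+ 2 <= 1 / 4.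
Proof.
rewrite /wild_abscissa exprMn cos2sin2; set a := sin _ ^+ 2.
rewrite -subr_ge0; have -> : 1 / 4 - a * (1 - a) = (a - 1 / 2) ^+ 2 by field.
exact: sqr_ge0.
Qed.

Lemma norm_wild_abscissa_le1 t : `|wild_abscissa t| <= 1.
Proof.
rewrite -(@ler_pXn2r _ 2)// ?nnegrE// real_normK ?num_real// expr1n.
by apply: le_trans (wild_abscissa_le t) _; lra.
Qed.

Lemma osc_wild_abscissa t : `|osc (wild_abscissa t)| <= 1 / 4.
Proof. exact: le_trans (osc_le _) (wild_abscissa_le t). Qed.

Lemma is_derive_pi_mul (f : R -> R) (df : R) (t : R) :
  is_derive (pi * t) 1 f df -> is_derive t 1 (fun s => f (pi * s)) (pi * df).
Proof.
move=> fd; have h : is_derive t 1 (fun s : R => pi * s) pi.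
  apply: (is_derive_eq (is_deriveM (is_derive_cst (pi : R) t 1) (is_derive_id t 1))).
  by rewrite /GRing.scale/=; ring.
by apply: (is_derive_eq (is_derive1_comp (g := fun s => pi * s) fd h)); rewrite mulrC.
Qed.

Lemma is_derive_wild_abscissa (t : R) : is_derive t 1 wild_abscissa (dwild_abscissa t).
Proof.
have ds := is_derive_pi_mul (is_derive_sin (pi * t)).
have dc := is_derive_pi_mul (is_derive_cos (pi * t)).
apply: (is_derive_eq (is_deriveM ds dc)).
by rewrite /dwild_abscissa /GRing.scale/=; ring.
Qed.

Lemma is_derive_wild (t : R) : is_derive t 1 wild (dwild t).
Proof.
have ds := is_derive_pi_mul (is_derive_sin (pi * t)).
have dc := is_derive_pi_mul (is_derive_cos (pi * t)).
apply: is_derive_pair; first exact: is_derive_wild_abscissa.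
have dE := is_derive1_comp (is_derive_osc (wild_abscissa t)) (is_derive_wild_abscissa t).
have H := is_deriveD (is_deriveM ds ds) (is_deriveM (is_deriveM dc dc) dE).
apply: (is_derive_eq H).
rewrite /dwild /= /GRing.scale/=.
rewrite -[(_ * _) t]/(cos (pi * t) * cos (pi * t)) /wild_abscissa; ring.
Qed.

Lemma continuous_sin_pi : continuous (fun t : R => sin (pi * t)).
Proof. by move=> t; exact: is_derive_continuous (is_derive_pi_mul (is_derive_sin (pi * t))). Qed.

Lemma continuous_cos_pi : continuous (fun t : R => cos (pi * t)).
Proof. by move=> t; exact: is_derive_continuous (is_derive_pi_mul (is_derive_cos (pi * t))). Qed.

Lemma continuous_wild_abscissa : continuous wild_abscissa.
Proof. by move=> t; exact: is_derive_continuous (is_derive_wild_abscissa t). Qed.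

Lemma continuous_dwild_abscissa : continuous dwild_abscissa.
Proof.
move=> t; apply: cvgM; first exact: cvg_cst.
by apply: cvgB; apply: (cvg_comp _ (fun z : R => z ^+ 2));
  [exact: continuous_cos_pi|exact: exprn_continuous|
   exact: continuous_sin_pi|exact: exprn_continuous].
Qed.

(** At the top of the circle the derivative of [osc] is evaluated at 0, where it
    is discontinuous, but multiplied by the square of a vanishing cosine. *)
Lemma wild_C1 t : sin (pi * t) != 0 -> C1_at wild dwild t.
Proof.
move=> s0; split; first by near=> u; exact: is_derive_wild.
suff c2 : {for t, continuous (fun u => (dwild u).2)}.
  exact: (cvg_pair (@continuous_dwild_abscissa t) c2).
have co : {for t, continuous (osc \o wild_abscissa)}.
  by apply: continuous_comp; [exact: continuous_wild_abscissa|exact: continuous_osc].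
apply: cvgD.
  apply: cvgM; last by apply: cvgB; [exact: cvg_cst|exact: co].
  by apply: cvgM; [exact: cvg_cst|exact: continuous_wild_abscissa].
apply: cvgM; last exact: continuous_dwild_abscissa.
have cc : {for t, continuous (fun u : R => cos (pi * u) ^+ 2)}.
  by apply: (cvg_comp _ (fun z : R => z ^+ 2)); [exact: continuous_cos_pi|exact: exprn_continuous].
have [c0|c0] := eqVneq (cos (pi * t)) 0; last first.
  have x0 : wild_abscissa t != 0 by rewrite mulf_neq0.
  apply: cvgM; first exact: cc.
  by apply: continuous_comp; [exact: continuous_wild_abscissa|exact: continuous_dosc].
rewrite c0 expr0n mul0r; apply: norm_cvg0.
have B0 : cos (pi * u) ^+ 2 * 3 @[u --> t] --> (0 : R).
  have := cvgM cc (cvg_cst (3 : R)); rewrite c0 expr0n mul0r; exact.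
apply: (squeeze_cvgr _ (cvg_cst 0) B0); near=> u.
rewrite normr_ge0/= normrM ger0_norm ?sqr_ge0// ler_wpM2l ?sqr_ge0//.
by rewrite dosc_le// norm_wild_abscissa_le1.
Unshelve. all: by end_near. Qed.

Lemma dwild_neq0 t : sin (pi * t) != 0 -> dwild t != 0.
Proof.
move=> s0; apply/negP => /eqP[/eqP x0 /eqP].
have pi0 : (pi : R) != 0 by rewrite gt_eqF// pi_gt0.
move: (x0); rewrite /dwild_abscissa mulf_eq0 (negPf pi0)/= subr_eq0 => /eqP cs.
have c0 : cos (pi * t) != 0.
  by rewrite -sqrf_eq0 cs sqrf_eq0.
rewrite cs subrr !mulr0 addr0 !mulf_eq0 pnatr_eq0 (negPf pi0) /=.
rewrite (negPf s0) (negPf c0)/= subr_eq0 => /eqP E.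
by have := osc_wild_abscissa t; rewrite -E normr1; lra.
Qed.

Lemma wild_periodic t : wild (t + 1) = wild t.
Proof.
have E : pi * (t + 1) = pi * t + pi :> R by ring.
have x : wild_abscissa (t + 1) = wild_abscissa t by rewrite /wild_abscissa E sinDpi cosDpi mulrNN.
by rewrite /wild x E sinDpi cosDpi !sqrrN.
Qed.

Lemma sin_pi_neq0 t : 0 < t < 1 -> sin (pi * t : R) != 0.
Proof.
move=> /andP[t0 t1]; rewrite gt_eqF// sin_gt0_pi// mulr_gt0 ?pi_gt0//=.
by rewrite -[ltRHS]mulr1 ltr_pM2l ?pi_gt0.
Qed.

(** The abscissa determines the shear, hence the point of the circle. *)
Lemma wild_inj s t : 0 <= s < 1 -> 0 <= t < 1 -> wild s = wild t -> s = t.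
Proof.
move=> s01 t01 [xE]; rewrite -xE => yE.
have pi0 : 0 < (pi : R) by exact: pi_gt0.
have E1 : osc (wild_abscissa s) != 1.
  by apply/negP => /eqP E; have := osc_wild_abscissa s; rewrite E normr1; lra.
have s2 : sin (pi * s) ^+ 2 = sin (pi * t) ^+ 2.
  have : (sin (pi * s) ^+ 2 - sin (pi * t) ^+ 2) * (1 - osc (wild_abscissa s)) = 0.
    move: yE; rewrite !cos2sin2; set a := sin (pi * s) ^+ 2.
    set b := sin (pi * t) ^+ 2; set e := osc _ => yE.
    have -> : (a - b) * (1 - e) = (a + (1 - a) * e) - (b + (1 - b) * e) by ring.
    by rewrite yE subrr.
  move/eqP; rewrite mulf_eq0 => /orP[|]; first by rewrite subr_eq0 => /eqP.
  by rewrite subr_eq0 eq_sym (negPf E1).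
have itv (u : R) : 0 <= u < 1 -> pi * u \in `[0, pi].
  move=> /andP[u0 u1]; rewrite in_itv/= (mulr_ge0 (ltW pi0) u0)/=.
  by rewrite -[leRHS]mulr1 ler_pM2l// ltW.
have sge (u : R) : 0 <= u < 1 -> 0 <= sin (pi * u).
  by move=> /itv; rewrite in_itv => /sin_ge0_pi.
have ss : sin (pi * s) = sin (pi * t).
  by apply/eqP; rewrite -(eqrXn2 (n := 2))// ?s2 ?sge.
have [z|nz] := eqVneq (sin (pi * s)) 0.
  have zero (u : R) : 0 <= u < 1 -> sin (pi * u) = 0 -> u = 0.
    move=> /andP[u0 u1] su; apply/eqP/negPn/negP => un.
    have : 0 < u < 1 by rewrite u1 lt_def un u0.
    by move=> /sin_pi_neq0; rewrite su eqxx.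
  by rewrite (zero s s01 z) (zero t t01)// -ss.
have cc : cos (pi * s) = cos (pi * t).
  by move: xE; rewrite /wild_abscissa -ss => /(mulfI nz).
have := cos_inj (itv _ s01) (itv _ t01) cc.
by move/(mulfI (lt0r_neq0 pi0)).
Qed.

(** The equation of the circle in sheared coordinates; it describes the curve
    independently of any parametrization. *)
Lemma wild_implicit_eq t : ((wild t).2 - osc (wild t).1) * (1 - (wild t).2) =
  (wild t).1 ^+ 2 * (1 - osc (wild t).1) ^+ 2.
Proof. by rewrite /wild /=; set e := osc _; rewrite /wild_abscissa cos2sin2 exprMn cos2sin2; ring. Qed.

Lemma wild0 : wild 0 = 0.
Proof. by rewrite /wild /wild_abscissa mulr0 sin0 mul0r expr0n osc0 mulr0 addr0. Qed.

Lemma dwild0 : dwild 0 = (pi, 0).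
Proof.
rewrite /dwild /dwild_abscissa /wild_abscissa mulr0 sin0 cos0 mul0r osc0 dosc0.
by congr pair; ring.
Qed.

Lemma nsq_wild t : nsq (wild t) <= 4.
Proof.
have x2 := wild_abscissa_le t; have ox := osc_wild_abscissa t.
have y1 : `|(wild t).2| <= 1.
  have a0 := sqr_ge0 (sin (pi * t)); have b0 := sqr_ge0 (cos (pi * t)).
  have := cos2Dsin2 (pi * t); rewrite /wild /=.
  move: a0 b0; set a := sin _ ^+ 2; set b := cos _ ^+ 2 => a0 b0 ab.
  apply: le_trans (ler_normD _ _) _; rewrite [`|b * _|]normrM (ger0_norm a0) (ger0_norm b0).
  rewrite -ab addrC lerD2r -[leRHS]mulr1.
  by apply: ler_wpM2l => //; lra.
have y2 : (wild t).2 ^+ 2 <= 1 by rewrite -real_normK ?num_real// exprn_ile1.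
have -> : nsq (wild t) = wild_abscissa t ^+ 2 + (wild t).2 ^+ 2 by rewrite /nsq /dot -!expr2.
lra.
Qed.

Lemma wild_near : \forall t \near (0 : R)^', [/\ C1_at wild dwild t,
  `|dwild t| <= 7 * pi & nsq (dwild 0) / 2 <= dot (dwild t) (dwild 0)].
Proof.
have pi0 : 0 < (pi : R) by exact: pi_gt0.
have c2 t : 0 <= cos (pi * t : R) ^+ 2 <= 1.
  by rewrite sqr_ge0 cos2sin2 gerBl sqr_ge0.
have bx t : `|dwild_abscissa t| <= pi.
  rewrite /dwild_abscissa normrM gtr0_norm// -[leRHS]mulr1 (ler_wpM2l (ltW pi0))//.
  rewrite sin2cos2 ler_norml.
  by have /andP[h1 h2] := c2 t; apply/andP; split; lra.
have by_ t : `|(dwild t).2| <= 7 * pi.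
  have -> : 7 * pi = 4 * pi + 3 * pi :> R by ring.
  move: (bx t) (norm_wild_abscissa_le1 t) (osc_wild_abscissa t) (dosc_le (norm_wild_abscissa_le1 t)) (c2 t).
  rewrite /dwild /=.
  move: (cos (pi * t) ^+ 2) (dwild_abscissa t) (wild_abscissa t) (dosc (wild_abscissa t)) (osc (wild_abscissa t)).
  move=> k dx x e o dx1 x1 o1 e3 /andP[k0 k1].
  apply: le_trans (ler_normD _ _) _; apply: lerD.
    rewrite !normrM (gtr0_norm pi0) ger0_norm//.
    have h2 : `|1 - o| <= 2.
      by move: o1; rewrite !ler_norml => /andP[? ?]; apply/andP; split; lra.
    have -> : 4 * pi = 2 * pi * 1 * 2 :> R by ring.
    have h0 : 0 <= 2 * pi :> R by rewrite mulr_ge0// ltW.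
    apply: ler_pM => //; first exact: mulr_ge0.
    exact: ler_wpM2l.
  rewrite !normrM; apply: ler_pM => //.
  by rewrite -[leRHS]mul1r; apply: ler_pM => //; rewrite ger0_norm.
have near1 : \forall t \near (0 : R), pi / 2 < dwild_abscissa t.
  have := @continuous_dwild_abscissa 0 => /(cvgr_gt _); apply.
  by rewrite /dwild_abscissa mulr0 sin0 cos0 expr1n expr0n/= subr0 mulr1; lra.
have nlt1 : \forall t \near (0 : R), `|t| < 1.
  by exists 1 => //= t; rewrite /= ?sub0r ?normrN.
have n0 : \forall u \near (0 : R)^', u != 0 by exact: nbhs_dnbhs_neq.
near=> t; split.
- apply: wild_C1; have t0 : t != 0 by near: t; exact: n0.
  have t1 : `|t| < 1 by near: t; exact: nbhs_dnbhs nlt1.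
  have [tp|tn|tz] := ltgtP 0 t; last by rewrite -tz eqxx in t0.
    by apply: sin_pi_neq0; rewrite tp/=; apply: le_lt_trans t1; exact: ler_norm.
  rewrite -[t]opprK mulrN sinN oppr_eq0; apply: sin_pi_neq0.
  by rewrite oppr_gt0 tn/=; apply: le_lt_trans t1; rewrite -normrN ler_norm.
- rewrite [leLHS]/(Num.max _ _) ge_max by_ andbT.
  by apply: le_trans (bx t) _; lra.
- rewrite dwild0 /nsq /dot /= !mulr0 !addr0.
  have : pi / 2 < dwild_abscissa t by near: t; exact: nbhs_dnbhs near1.
  by move=> /ltW h; rewrite mulrAC ler_pM2r.
Unshelve. all: by end_near. Qed.

End WildCurve.

(** Differentiating the relation at 0 shows that [dy 0] is horizontal, hence the
    abscissa [X] takes all small values of one sign.  Differentiating it at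
    nearby parameters expresses [dosc (X t) * dX t] through quantities that tend
    to 0, against [dosc_peak]. *)
Lemma no_C1_oscillation (R : realType) (y dy : R -> R * R) : C1_at y dy 0 ->
  y 0 = 0 -> dy 0 != 0 ->
  ~ (\forall t \near (0 : R), ((y t).2 - osc (y t).1) * (1 - (y t).2) =
      (y t).1 ^+ 2 * (1 - osc (y t).1) ^+ 2).
Proof.
move=> C y0 dy0 rel.
pose X t := (y t).1; pose Y t := (y t).2.
pose dX t := (dy t).1; pose dY t := (dy t).2.
have [ydy cdy] := C.
have cy : {for 0, continuous y} := C1_at_continuous C.
have nX : \forall t \near (0 : R), is_derive (t : R) 1 X (dX t).
  by apply: filterS ydy => t /is_derive_pairP[].
have nY : \forall t \near (0 : R), is_derive (t : R) 1 Y (dY t).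
  by apply: filterS ydy => t /is_derive_pairP[].
have X0 : X 0 = 0 by rewrite /X y0.
have Y0 : Y 0 = 0 by rewrite /Y y0.
have cX : {for 0, continuous X} by exact: cvg_fst2 cy.
have cY : {for 0, continuous Y} by exact: cvg_snd2 cy.
have cdX : {for 0, continuous dX} by exact: cvg_fst2 cdy.
have cdY : {for 0, continuous dY} by exact: cvg_snd2 cdy.
have coX : {for 0, continuous (osc \o X)} by apply: continuous_comp; [exact: cX|exact: continuous_osc].
(* The derivative of the relation, solved for the term in [dosc]. *)
have key : \forall t \near (0 : R),
   dosc (X t) * dX t * (1 - Y t - 2 * X t ^+ 2 * (1 - osc (X t))) =
   dY t * (1 - Y t) - (Y t - osc (X t)) * dY t
     - 2 * X t * dX t * (1 - osc (X t)) ^+ 2.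
  have rel' := near_join rel; near=> t.
  have tX : is_derive (t : R) 1 X (dX t) by near: t.
  have tY : is_derive (t : R) 1 Y (dY t) by near: t.
  have trel : \forall u \near t, (Y u - osc (X u)) * (1 - Y u) =
      X u ^+ 2 * (1 - osc (X u)) ^+ 2 by near: t.
  have tE := is_derive1_comp (is_derive_osc (X t)) tX.
  have h1 := is_deriveB (is_derive_cst (1 : R) t 1) tY.
  have h2 := is_deriveM (is_deriveB tY tE) h1.
  have h3 := is_deriveB (is_derive_cst (1 : R) t 1) tE.
  have h4 := is_deriveM (is_deriveM tX tX) (is_deriveM h3 h3).
  have trel' : \forall u \near t, ((Y - (osc \o X)) * (cst 1 - Y)) u =
      ((X * X) * ((cst 1 - (osc \o X)) * (cst 1 - (osc \o X)))) u.
    by apply: filterS trel => u E; rewrite -[LHS]/((Y u - osc (X u)) * (1 - Y u)) E !expr2.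
  have h5 := near_eq_is_derive trel' h2.
  have [_ E4] := h4; have [_ E5] := h5; move: E5; rewrite E4.
  rewrite -[(X * X) t]/(X t * X t) -[((_ - _) * _) t]/((1 - osc (X t)) * (1 - osc (X t))).
  rewrite -[(cst 1 - (osc \o X)) t]/(1 - osc (X t)) -[(Y - (osc \o X)) t]/(Y t - osc (X t)).
  rewrite -[(cst 1 - Y) t]/(1 - Y t) /GRing.scale/=.
  set E := osc (X t); set D := dosc (X t) => H.
  apply/eqP; rewrite -subr_eq0; move/eqP: H; rewrite -subr_eq0.
  by congr (_ == 0); ring.
have dY0 : dY 0 = 0.
  have := nbhs_singleton key; rewrite X0 Y0 dosc0 osc0.
  by move=> H; lra.
have dX0 : dX 0 != 0.
  apply: contra dy0 => /eqP E; apply/eqP.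
  by rewrite [dy 0]surjective_pairing -/(dX 0) -/(dY 0) E dY0.
set a := `|dX 0|; have a0 : 0 < a by rewrite normr_gt0.
have lim1 : (fun t => 1 - Y t - 2 * X t ^+ 2 * (1 - osc (X t))) @ (0 : R) --> (1 : R).
  have L : (fun t => 1 - Y t - 2 * X t ^+ 2 * (1 - osc (X t))) @ (0 : R) -->
      1 - Y 0 - 2 * X 0 ^+ 2 * (1 - osc (X 0)).
    apply: cvgB; first by apply: cvgB; [exact: cvg_cst|exact: cY].
    apply: cvgM; last by apply: cvgB; [exact: cvg_cst|exact: coX].
    apply: cvgM; first exact: cvg_cst.
    by apply: (cvg_comp X (fun z : R => z ^+ 2)); [exact: cX|exact: exprn_continuous].
  by move: L; rewrite X0 Y0 expr0n/= mulr0 mul0r !subr0; apply.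
have lim2 : (fun t => dY t * (1 - Y t) - (Y t - osc (X t)) * dY t
     - 2 * X t * dX t * (1 - osc (X t)) ^+ 2) @ (0 : R) --> (0 : R).
  have L : (fun t => dY t * (1 - Y t) - (Y t - osc (X t)) * dY t
     - 2 * X t * dX t * (1 - osc (X t)) ^+ 2) @ (0 : R) -->
     dY 0 * (1 - Y 0) - (Y 0 - osc (X 0)) * dY 0
     - 2 * X 0 * dX 0 * (1 - osc (X 0)) ^+ 2.
    have c1 : (fun t => 1 - osc (X t)) @ (0 : R) --> 1 - osc (X 0).
      by apply: cvgB; [exact: cvg_cst|exact: coX].
    apply: cvgB; first apply: cvgB.
    - by apply: cvgM; [exact: cdY|apply: cvgB; [exact: cvg_cst|exact: cY]].
    - by apply: cvgM; [apply: cvgB; [exact: cY|exact: coX]|exact: cdY].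
    apply: cvgM; last by apply: (cvg_comp _ (fun z : R => z ^+ 2) c1); exact: exprn_continuous.
    by apply: cvgM; [apply: cvgM; [exact: cvg_cst|exact: cX]|exact: cdX].
  by move: L; rewrite X0 Y0 dY0 !mul0r !mulr0 !mul0r !subr0; apply.
have n1 : \forall t \near (0 : R), 1 / 2 < 1 - Y t - 2 * X t ^+ 2 * (1 - osc (X t)).
  by apply: (cvgr_gt _ lim1); lra.
have n2 : \forall t \near (0 : R), `|dY t * (1 - Y t) - (Y t - osc (X t)) * dY t
     - 2 * X t * dX t * (1 - osc (X t)) ^+ 2| < a / 8.
  have a8 : 0 < a / 8 by rewrite divr_gt0.
  move/cvgrPdist_lt : lim2 => /(_ _ a8).
  by apply: filterS => t; rewrite sub0r normrN.
have n3 : \forall t \near (0 : R), a / 2 < `|dX t|.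
  have : {for 0, continuous (fun t => `|dX t|)} by apply: cvg_norm; exact: cdX.
  by move=> /(cvgr_gt _); apply; rewrite -/a; lra.
have [r /= r0 B] : \forall t \near (0 : R), [/\ is_derive (t : R) 1 X (dX t),
    a / 2 < `|dX t| & `|dosc (X t)| < 1].
  near=> t; split.
  - by near: t.
  - by near: t.
  have e1 : 1 / 2 < 1 - Y t - 2 * X t ^+ 2 * (1 - osc (X t)) by near: t.
  have e3 : a / 2 < `|dX t| by near: t.
  have e2 : `|dosc (X t) * dX t * (1 - Y t - 2 * X t ^+ 2 * (1 - osc (X t)))| < a / 8.
    rewrite (_ : dosc (X t) * _ * _ = dY t * (1 - Y t) - (Y t - osc (X t)) * dY t
       - 2 * X t * dX t * (1 - osc (X t)) ^+ 2); last by near: t.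
    by near: t.
  rewrite ltNge; apply/negP => d1; move: e2; rewrite ltNge => /negP; apply.
  rewrite !normrM; apply: (@le_trans _ _ (1 * (a / 2) * (1 / 2))); first lra.
  apply: ler_pM; [lra|lra| |].
    by apply: ler_pM => //; lra.
  by rewrite ger0_norm; lra.
have inr t : 0 <= t <= r / 2 -> [/\ is_derive (t : R) 1 X (dX t),
    a / 2 < `|dX t| & `|dosc (X t)| < 1].
  move=> /andP[t0 t1]; apply: B; rewrite /= sub0r normrN ger0_norm//; lra.
have r2 : 0 < r / 2 by rewrite divr_gt0.
have cXr : {within `[0, r / 2], continuous X}.
  apply: continuous_in_subspaceT => x; rewrite inE/= in_itv/= => /inr[Xx _ _].
  exact: is_derive_continuous Xx.
(* [X] vanishes at 0 but not at [r / 2], as its derivative has no zero in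
   between. *)
set b := X (r / 2).
have b0 : b != 0.
  have [|x xI E] := @MVT R X dX 0 (r / 2) r2 _ cXr.
    move=> x; rewrite in_itv/= => /andP[x0 x1].
    by have [|] := inr x; first by rewrite !ltW.
  move: E; rewrite X0 !subr0 -/b => ->; apply: mulf_neq0; last by rewrite gt_eqF.
  move: xI; rewrite in_itv/= => /andP[x0 x1].
  have [|_ h _] := inr x; first by rewrite !ltW.
  by rewrite -normr_eq0 gt_eqF//; apply: le_lt_trans h; lra.
have [x [xb sgn d1]] := dosc_peak b0.
have [|t tI Xt] := @IVT R X 0 (r / 2) x (ltW r2) cXr.
  rewrite X0 -/b.
  have [bp|bn|bz] := ltgtP b 0; last by rewrite bz eqxx in b0.
    have xn : x < 0 by move: sgn; rewrite nmulr_lgt0.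
    by move: xb; rewrite !ltr0_norm// => xb; apply/andP; split; lra.
  have xp : 0 < x by move: sgn; rewrite pmulr_lgt0.
  by move: xb; rewrite !gtr0_norm// => xb; apply/andP; split; lra.
have [|_ _] := inr t; first by move: tI; rewrite in_itv.
by rewrite Xt d1 ltxx.
Unshelve. all: by end_near. Qed.

(** * Failure for the inverse *)

Section Counterexample.
Context {R : realType} (S : smooth_surface R) (p0 : S) (c : chart R S).
Hypotheses (c_aff : affine_chart c) (cp0 : chart_dom c p0) (c0 : c p0 = 0)
  (c_cod : forall x, nsq x <= 4 -> chart_cod c x).

Definition wild_curve (t : R) : S := chart_inv c (wild t).

Lemma wild_cod t : chart_cod c (wild t). Proof. exact/c_cod/nsq_wild. Qed.

Lemma chart_wild t : c (wild_curve t) = wild t.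
Proof. by rewrite /wild_curve chart_invK//; exact: wild_cod. Qed.

Lemma wild_curve_dom t : chart_dom c (wild_curve t).
Proof. exact/chart_inv_dom/wild_cod. Qed.

Lemma wild_curve0 : wild_curve 0 = p0.
Proof. by rewrite /wild_curve wild0 -c0 chart_mapK. Qed.

Lemma wild_curve_not_C1 : ~ C1_curve (range wild_curve).
Proof.
move=> [beta bC]; have : range wild_curve p0 by exists 0 => //; exact: wild_curve0.
have [_ _ _ bE] := bC; rewrite bE => -[a _ ba].
have gC := C1_parametrization_shift a bC.
set g := (fun s => beta (s + a)) in gC.
have [_ _ reg gE] := (C1_parametrizationP _ _).1 gC.
have g0 : g 0 = p0 by rewrite /g add0r.
have dg : chart_dom c (g 0) by rewrite g0.
have [dy C dy0] := regular_chart (reg 0) c_aff dg.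
apply: (no_C1_oscillation C _ dy0); first by rewrite /= g0.
near=> t; have : range g (g t) by exists t.
by rewrite -gE => -[s _ sE]; rewrite /= -sE chart_wild wild_implicit_eq.
Unshelve. all: by end_near. Qed.

(** The velocities of [wild] are bounded and keep a positive first component
    near 0, which is all that [pinch_curve] requires. *)
Lemma wild_curve_image_C1 : C1_curve (pinch c @` range wild_curve).
Proof.
have cE : c \o wild_curve = wild by apply/funext => t /=; exact: chart_wild.
have cw : continuous wild_curve.
  move=> t; apply: continuous_comp; first exact: is_derive_continuous (is_derive_wild t).
  exact/chart_inv_continuous/wild_cod.
have per t : wild_curve (t + 1) = wild_curve t by rewrite /wild_curve wild_periodic.
have inj s t : 0 <= s < 1 -> 0 <= t < 1 -> wild_curve s = wild_curve t -> s = t.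
  by move=> s01 t01 /(congr1 c); rewrite !chart_wild; exact: wild_inj.
have d0 : is_derive (0 : R) 1 (c \o wild_curve) (dwild 0) by rewrite cE; exact: is_derive_wild.
have d0N : dwild (0 : R) != 0.
  rewrite dwild0; apply/negP => /eqP[/eqP]; rewrite gt_eqF//; exact: pi_gt0.
have nr : \forall t \near (0 : R)^', [/\ C1_at (c \o wild_curve) dwild t,
    `|dwild t| <= 7 * pi & nsq (dwild 0) / 2 <= dot (dwild t) (dwild 0)].
  by rewrite cE; exact: wild_near.
have reg t : wild_curve t != p0 -> regular wild_curve t.
  move=> tp; split; first exact: cw.
  have s0 : sin (pi * t) != 0.
    apply: contra tp => /eqP s0; rewrite -wild_curve0 /wild_curve.
    rewrite wild0 /wild /wild_abscissa s0 mul0r expr0n osc0 mulr0 addr0.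
    by [].
  exists c, dwild; split; [exact: c_aff|exact: wild_curve_dom| |exact: dwild_neq0].
  by rewrite cE; exact: wild_C1.
have [H [HC _ _ _]] := pinch_curve c_aff cp0 c0 c_cod per inj wild_curve0 cw reg d0 d0N nr.
by exists (pinch c \o wild_curve \o H); rewrite image_comp.
Qed.

End Counterexample.

Unset Implicit Arguments.

Theorem proposition3 (R : realType) (S : smooth_surface R) :
  exists f : S -> S,
    [/\ (Homeo S `\` Homeo1 S) f,
        maps_C1_curves f &
        forall p : S, exists F : PT p -> PT (f p),
          induced_map f p F /\ homeomorphism F].
Proof.
have [p0 _] := surface_nonempty S.
have [c [c_aff cp0 c0 c_cod]] := normal_chart p0.
exists (pinch c); split.
- split; first exact: pinch_homeo.
  move=> [g [[_ _ pK _] [_ gC1]]].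
  apply: (wild_curve_not_C1 c_aff cp0 c0 c_cod).
  have := gC1 _ (wild_curve_image_C1 c_aff cp0 c0 c_cod).
  rewrite image_comp (_ : g \o pinch c = id) ?image_id//.
  by apply/funext.
- exact: (pinch_maps_C1 c_aff cp0 c0 c_cod).
- exact: (pinch_induced c_aff cp0 c0 c_cod).
Qed.
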